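(* Let $p$ be a prime with $p\equiv1\pmod3$, $\theta\in\mathcal{E}_p$, $q\in\mathbb{Q}_p$, and suppose $0<|q|_p^{\frac{m+1}{m}}\le|\theta-1|_p<|q|_p^{\frac{m+2}{m+1}}<1$ for some integer $m\ge1$. Let $f=f_{\theta,q,3}$. Then: (i) $(\mathbb{X}_m,\mathcal{J}_m,f)$ is transitive, and the dynamical system $f:\mathcal{J}_m\to\mathcal{J}_m$ (with the metric induced by $|\cdot|_p$) is isometrically conjugate to the subshift dynamics $(\Sigma_{A_m},\sigma_{A_m},d_f)$ on $m+3$ symbols with $$A_m=\begin{pmatrix}\mathbf{e}_1^T&\mathbf{I}_m&\mathbf{0}^T&\mathbf{0}^T\\0&\mathbf{0}&1&1\\1&\mathbf{1}&1&1\\1&\mathbf{1}&1&1\end{pmatrix},$$ where $\mathbf{I}_m$ is the $m\times m$ identity matrix and $\mathbf{e}_1=(1,0,\dots,0)$, $\mathbf{1}=(1,\dots,1)$, $\mathbf{0}=(0,\dots,0)$ are row vectors of length $m$. Moreover, this subshift is topologically conjugate to the full shift on three symbols. (ii) $\mathbb{Q}_p=\mathfrak{B}(\mathbf{x}^{(0)})\cup\mathcal{J}_m\cup\bigcup_{n=0}^{+\infty}f^{-n}\{\mathbf{x}^{(\infty)}\}$.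
   Context: $\mathcal{E}_p=\{x\in\mathbb{Q}_p:|x-1|_p<p^{-1/(p-1)}\}$; $\mathbb{B}_\rho(a)=\{x\in\mathbb{Q}_p:|x-a|_p<\rho\}$. The Potts--Bethe mapping is $f_{\theta,q,3}(x)=\left(\frac{\theta x+q-1}{x+\theta+q-2}\right)^3$, defined on $\mathbb{Q}_p\setminus\{\mathbf{x}^{(\infty)}\}$, $\mathbf{x}^{(\infty)}=2-\theta-q$. For $S\subset\mathbb{Q}_p$, $n\ge0$, $f^{-n}(S)$ is the set of $x$ for which $f^n(x)$ is defined and lies in $S$. The cubic $y^3-(1+\theta+\theta^2)y^2-(2\theta+1)(1-\theta-q)y-(1-\theta-q)^2=0$ has three roots $\mathbf{y}^{(1)},\mathbf{y}^{(2)},\mathbf{y}^{(3)}\in\mathbb{Z}_p$, labelled so that $|\mathbf{y}^{(1)}|_p=1>|\mathbf{y}^{(2)}|_p=|\mathbf{y}^{(3)}|_p=|1-\theta-q|_p$. Set $\mathbf{x}^{(0)}=1$, $\mathbf{x}^{(i)}=1-q+(\theta-1)(\mathbf{y}^{(i)}-1)$ for $i=1,2,3$. $\mathfrak{B}(\mathbf{x}^{(0)})=\{x\in\mathbb{Q}_p:\lim_{n\to\infty}f^n(x)=\mathbf{x}^{(0)}\}$ (all iterates defined). Let $r=|q|_p|\theta-1|_p$, $\mathcal{D}_1=\mathbb{B}_r(\mathbf{x}^{(1)})$, $\mathcal{C}_2=\{x:|x-\mathbf{x}^{(2)}|_p<|x-\mathbf{x}^{(\infty)}|_p=r\}=\mathbb{B}_r(\mathbf{x}^{(2)})$,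 $\mathcal{C}_3=\{x:|x-\mathbf{x}^{(3)}|_p<|x-\mathbf{x}^{(\infty)}|_p=r\}=\mathbb{B}_r(\mathbf{x}^{(3)})$. For $0\le l\le m$ let $\mathcal{G}_l=\{x\in\mathbb{Q}_p:|x-\mathbf{x}^{(1)}|_p=|\theta-1|_p^{l+1}/|q|_p^l\}$, a finite disjoint union of open balls of radius $r$. For $1\le l\le m$, $\mathcal{H}_l$ is the unique ball of radius $r$ contained in $\mathcal{G}_l$ such that $\mathcal{C}_2\cup\mathcal{C}_3\subset f^l(\mathcal{H}_l)$. Put $\mathbb{X}_m=\mathcal{D}_1\cup\mathcal{H}_m\cup\cdots\cup\mathcal{H}_1\cup\mathcal{C}_2\cup\mathcal{C}_3$ and $\mathcal{J}_m=\bigcap_{n=0}^\infty f^{-n}(\mathbb{X}_m)$. Index the $m+3$ balls of radius $r$ composing $\mathbb{X}_m$ in the order $\mathcal{D}_1,\mathcal{H}_m,\dots,\mathcal{H}_1,\mathcal{C}_2,\mathcal{C}_3$ by $I=\{0,1,\dots,m+2\}$; let $B_i$ be the $i$-th ball and $a_i$ a center of it. The incidence matrix of $(\mathbb{X}_m,\mathcal{J}_m,f)$ is the matrix $(a_{ij})_{I\times I}$ with $a_{ij}=1$ if $B_j\subset f(B_i)$ (equivalently $B_j\cap f(B_i)\ne\emptyset$) and $a_{ij}=0$ otherwise; the triple is transitive if this matrix is irreducible. On each $B_i$ one has $|f(x)-f(y)|_p=p^{\tau_i}|x-y|_p$, with $p^{\tau_i}=|q|_p/|\theta-1|_p$ for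 $\mathcal{D}_1$ and the $\mathcal{H}_l$, and $p^{\tau_i}=1/(|q|_p|\theta-1|_p)$ for $\mathcal{C}_2,\mathcal{C}_3$. For $i\ne j$, $\kappa(i,j)$ is the integer with $|a_i-a_j|_p=p^{-\kappa(i,j)}$. For a $0$-$1$ matrix $A$ indexed by $I$, $\Sigma_A=\{(x_k)_{k\ge0}:x_k\in I,\ A_{x_k,x_{k+1}}=1\ \forall k\ge0\}$ and $\sigma_A$ is the left shift on it. For distinct $x,y\in\Sigma_{A_m}$ with $n=\min\{k\ge0:x_k\ne y_k\}$, $d_f(x,y)=p^{-\tau_{x_0}-\cdots-\tau_{x_{n-1}}-\kappa(x_n,y_n)}$ (which is $p^{-\kappa(x_0,y_0)}$ if $n=0$); $d_f$ induces the product topology. The full shift on three symbols is the left shift on one-sided infinite sequences over three symbols with the product topology. Isometrically conjugate means conjugate by a bijective isometry. *)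

(* Defs.v *)
From HB Require Import structures.
From mathcomp Require Import all_boot all_order all_algebra.
From mathcomp Require Import all_classical all_reals all_analysis.
From mathcomp Require Import zify ring.
Import Order.TTheory GRing.Theory Num.Theory.
Import numFieldNormedType.Exports.
Set Implicit Arguments.
Unset Strict Implicit.
Unset Printing Implicit Defensive.
Local Open Scope classical_set_scope.
Local Open Scope ring_scope.
Local Open Scope quotient_scope.

Definition rat_pval (p : nat) (x : rat) : int :=
  (logn p `|numq x|%N)%:Z - (logn p `|denq x|%N)%:Z.

Definition rat_pabs (p : nat) (x : rat) : rat :=
  if x == 0 then 0 else p%:R ^ (- rat_pval p x).

Section RatPabs.
Variables (p : nat) (hp : prime p).
Local Notation "`| x |_p" := (rat_pabs p x) (format "`| x |_p").

Lemma rat_pvalE (a b : int) : a != 0 -> b != 0 ->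
  rat_pval p (a%:~R / b%:~R) = (logn p `|a|)%:Z - (logn p `|b|)%:Z.
Proof.
move=> a0 b0; set x : rat := _ / _; rewrite /rat_pval.
have aQ : a%:~R != 0 :> rat by rewrite intr_eq0.
have bQ : b%:~R != 0 :> rat by rewrite intr_eq0.
have x0 : x != 0 by rewrite mulf_neq0 ?invr_eq0.
have e : numq x * b = a * denq x.
  apply/eqP; rewrite -(eqr_int rat) !intrM numqE.
  by rewrite mulrAC /x divfK.
have n0 : numq x != 0 by rewrite numq_eq0.
have := congr1 (fun t : int => logn p `|t|%N) e; rewrite /= !abszM.
by rewrite !lognM ?absz_gt0 ?denq_neq0 //; lia.
Qed.

Lemma rat_pval_frac (x : rat) : x = (numq x)%:~R / (denq x)%:~R.
Proof. by rewrite divq_num_den. Qed.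

Lemma rat_pvalM x y : x != 0 -> y != 0 ->
  rat_pval p (x * y) = rat_pval p x + rat_pval p y.
Proof.
move=> x0 y0; rewrite [x * y](_ : _ =
  (numq x * numq y)%:~R / (denq x * denq y)%:~R).
  rewrite rat_pvalE ?mulf_neq0 ?numq_eq0 ?denq_neq0 //.
  by rewrite /rat_pval !abszM !lognM ?absz_gt0 ?numq_eq0 ?denq_neq0 //; lia.
rewrite {1}(rat_pval_frac x) {1}(rat_pval_frac y) !intrM.
by rewrite invfM mulrACA.
Qed.

Lemma p_gt1 : 1 < p%:R :> rat.
Proof. by rewrite ltr1n prime_gt1. Qed.

Lemma p_gt0 : 0 < p%:R :> rat.
Proof. exact: lt_trans p_gt1. Qed.

Lemma rat_pabs_eq0 x : (`|x|_p == 0) = (x == 0).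
Proof.
rewrite /rat_pabs; case: ifP => _; first by rewrite eqxx.
by apply/negbTE; rewrite expfz_neq0 // gt_eqF // p_gt0.
Qed.

Lemma rat_pabs0 : `|0|_p = 0. Proof. by rewrite /rat_pabs eqxx. Qed.

Lemma rat_pabs_ge0 x : 0 <= `|x|_p.
Proof. by rewrite /rat_pabs; case: eqP => // _; rewrite exprz_ge0 // ltW // p_gt0. Qed.

Lemma rat_pabsM x y : `|x * y|_p = `|x|_p * `|y|_p.
Proof.
rewrite /rat_pabs mulf_eq0; case: eqVneq => [|x0]; first by rewrite mul0r.
case: eqVneq => [|y0]; first by rewrite mulr0.
by rewrite /= rat_pvalM // opprD expfzDr // gt_eqF // p_gt0.
Qed.

Lemma rat_pabsN x : `|- x|_p = `|x|_p.
Proof. by rewrite /rat_pabs oppr_eq0 /rat_pval numqN denqN abszN. Qed.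

Lemma rat_pabsB x y : `|x - y|_p = `|y - x|_p.
Proof. by rewrite -rat_pabsN opprB. Qed.

Lemma rat_pabs1 : `|1|_p = 1.
Proof. by rewrite /rat_pabs oner_eq0 /rat_pval /= !logn1. Qed.

Lemma rat_pabsV x : `|x^-1|_p = `|x|_p^-1.
Proof.
have [->|x0] := eqVneq x 0; first by rewrite !(invr0, rat_pabs0).
apply: (@mulfI _ `|x|_p); first by rewrite rat_pabs_eq0.
by rewrite -rat_pabsM divff ?rat_pabs1 ?divff ?rat_pabs_eq0.
Qed.

Lemma rat_pabsD x y : `|x + y|_p <= Num.max `|x|_p `|y|_p.
Proof.
have [->|x0] := eqVneq x 0; first by rewrite add0r le_max lexx orbT.
have [->|y0] := eqVneq y 0; first by rewrite addr0 le_max lexx.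
have [->|s0] := eqVneq (x + y) 0; first by rewrite rat_pabs0 le_max rat_pabs_ge0.
pose d : int := denq x * denq y; pose a : int := numq x * denq y.
pose b : int := numq y * denq x.
have dx : (denq x)%:~R != 0 :> rat by rewrite intr_eq0 denq_neq0.
have dy : (denq y)%:~R != 0 :> rat by rewrite intr_eq0 denq_neq0.
have d0 : d != 0 by rewrite mulf_neq0 ?denq_neq0.
have ex : x = a%:~R / d%:~R.
  by rewrite {1}(rat_pval_frac x) /a /d !intrM; field; rewrite dx dy.
have ey : y = b%:~R / d%:~R.
  by rewrite {1}(rat_pval_frac y) /b /d !intrM; field; rewrite dx dy.
have es : x + y = (a + b)%:~R / d%:~R by rewrite ex ey -mulrDl -intrD.
have a0 : a != 0 by rewrite mulf_neq0 ?denq_neq0 ?numq_eq0.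
have b0 : b != 0 by rewrite mulf_neq0 ?denq_neq0 ?numq_eq0.
have ab0 : a + b != 0.
  by apply: contra s0 => /eqP; rewrite es => ->; rewrite mul0r.
rewrite /rat_pabs (negbTE x0) (negbTE y0) (negbTE s0) le_max.
rewrite !ler_eXz2l ?p_gt1 // es ex ey !rat_pvalE //.
suff H : (minn (logn p (absz a)) (logn p (absz b)) <= logn p (absz (a + b)%R))%N by lia.
set k := minn _ _; rewrite -pfactor_dvdn ?absz_gt0 //.
have -> : (p ^ k %| absz (a + b)%R)%N = ((p ^ k)%:Z %| a + b)%Z by [].
by apply: rpredD; rewrite dvdzE /= pfactor_dvdn ?absz_gt0 //; rewrite geq_min leqnn ?orbT.
Qed.

Lemma rat_pabsD_lt x y e : `|x|_p < e -> `|y|_p < e -> `|x + y|_p < e.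
Proof. by move=> h k; apply: (le_lt_trans (rat_pabsD x y)); rewrite gt_max h. Qed.

(* The primality proof is a dummy argument: it lets the algebraic instances,
   which need it, be inferred from the type. *)
Definition pcauchy of prime p : {pred nat -> rat} := fun x =>
  `[< forall e : rat, 0 < e ->
      exists N, forall i j, (N <= i)%N -> (N <= j)%N -> `|x i - x j|_p < e >].

Lemma pcauchyP (x : nat -> rat) : reflect (forall e : rat, 0 < e ->
  exists N, forall i j, (N <= i)%N -> (N <= j)%N -> `|x i - x j|_p < e)
  (x \in pcauchy hp).
Proof. exact: asboolP. Qed.

Lemma pcauchy_bounded (x : nat -> rat) : x \in pcauchy hp ->
  exists2 M : rat, 0 < M & exists N, forall i, (N <= i)%N -> `|x i|_p <= M.
Proof.
move=> /pcauchyP /(_ 1 ltr01)[N hN]; exists (Num.max 1 `|x N|_p).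
  by rewrite lt_max ltr01.
exists N => i Ni; rewrite -(subrK (x N) (x i)).
apply: (le_trans (rat_pabsD _ _)); rewrite ge_max !le_max lexx orbT andbT.
by rewrite ltW // hN.
Qed.

Lemma pcauchy_subring : subring_closed (pcauchy hp).
Proof.
split.
- by apply/pcauchyP => e e0; exists 0%N => i j _ _; rewrite subrr rat_pabs0.
- move=> x y /pcauchyP cx /pcauchyP cy; apply/pcauchyP => e e0.
  have [N hN] := cx _ e0; have [M hM] := cy _ e0.
  exists (maxn N M) => i j; rewrite !geq_max => /andP[Ni Mi] /andP[Nj Mj].
  have -> : (x - y) i - (x - y) j = (x i - x j) + (y j - y i).
    by rewrite !fctE /=; ring.
  by apply: rat_pabsD_lt; [exact: hN|exact: hM].
- move=> x y cx cy; apply/pcauchyP => e e0.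
  have [A A0 [N1 bx]] := pcauchy_bounded cx.
  have [B B0 [N2 by_]] := pcauchy_bounded cy.
  move/pcauchyP: cx => /(_ _ (divr_gt0 e0 B0))[N3 cx].
  move/pcauchyP: cy => /(_ _ (divr_gt0 e0 A0))[N4 cy].
  exists (maxn (maxn N1 N2) (maxn N3 N4)) => i j.
  rewrite !geq_max => /andP[/andP[i1 i2] /andP[i3 i4]] /andP[/andP[j1 j2] /andP[j3 j4]].
  have -> : (x * y) i - (x * y) j = x i * (y i - y j) + (x i - x j) * y j.
    by rewrite !fctE /=; ring.
  apply: rat_pabsD_lt; rewrite rat_pabsM.
    apply: (@le_lt_trans _ _ (A * `|y i - y j|_p)).
      by rewrite ler_wpM2r ?rat_pabs_ge0 ?bx.
    by rewrite mulrC -ltr_pdivlMr // cy.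
  apply: (@le_lt_trans _ _ (`|x i - x j|_p * B)).
    by rewrite ler_wpM2l ?rat_pabs_ge0 ?by_.
  by rewrite -ltr_pdivlMr // cx.
Qed.

HB.instance Definition _ :=
  GRing.isSubringClosed.Build (nat -> rat) (pcauchy hp) pcauchy_subring.

Definition pcauchy_seq := {x : nat -> rat | x \in pcauchy hp}.
HB.instance Definition _ := [isSub of pcauchy_seq for (@sval _ _)].
HB.instance Definition _ := [Choice of pcauchy_seq by <:].
HB.instance Definition _ := [SubChoice_isSubComNzRing of pcauchy_seq by <:].

Definition pnull : {pred pcauchy_seq} := fun x =>
  `[< forall e : rat, 0 < e ->
      exists N, forall i, (N <= i)%N -> `|val x i|_p < e >].

Lemma pnullP (x : pcauchy_seq) : reflect (forall e : rat, 0 < e ->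
  exists N, forall i, (N <= i)%N -> `|val x i|_p < e) (x \in pnull).
Proof. exact: asboolP. Qed.

Lemma pnull_idealr : idealr_closed pnull.
Proof.
split.
- by apply/pnullP => e e0; exists 0%N => i _; rewrite /= rat_pabs0.
- apply/negP => /pnullP /(_ 1 ltr01)[N /(_ N (leqnn N))].
  by rewrite /= rat_pabs1 ltxx.
- move=> a x y /pnullP nx /pnullP ny; apply/pnullP => e e0.
  have [A A0 [N1 ba]] := pcauchy_bounded (valP a).
  have [N2 h2] := nx _ (divr_gt0 e0 A0); have [N3 h3] := ny _ e0.
  exists (maxn N1 (maxn N2 N3)) => i; rewrite !geq_max => /and3P[i1 i2 i3].
  apply: rat_pabsD_lt; last exact: h3.
  rewrite rat_pabsM.
  apply: (@le_lt_trans _ _ (A * `|val x i|_p)).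
    by rewrite ler_wpM2r ?rat_pabs_ge0 ?ba.
  by rewrite mulrC -ltr_pdivlMr // h2.
Qed.

HB.instance Definition _ := isIdealr.Build pcauchy_seq pnull pnull_idealr.

(* The field of p-adic numbers, as the completion of rat for rat_pabs p: Cauchy
   sequences modulo null sequences. *)
Definition Qp := {ideal_quot pnull}.
HB.instance Definition _ := GRing.ComNzRing.on Qp.

Lemma pnull_away (x : pcauchy_seq) : x \notin pnull ->
  exists2 c : rat, 0 < c & exists N, forall i, (N <= i)%N -> c <= `|val x i|_p.
Proof.
move=> /pnullP /existsNP[e /not_implyP[e0 /forallNP H]]; exists e => //.
have /pcauchyP/(_ e e0)[N hN] := valP x; exists N => i Ni.
have [j /not_implyP[Nj /negP]] := (existsNP _).2 (H N).
rewrite -leNgt => ej; rewrite leNgt; apply/negP => xi.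
suff : `|val x j|_p < e by rewrite ltNge ej.
by rewrite -(subrK (val x i) (val x j)); apply: rat_pabsD_lt => //; apply: hN.
Qed.

Definition pcauchy_inv (x : pcauchy_seq) : pcauchy_seq :=
  insubd (0 : pcauchy_seq) (fun n => (val x n)^-1).

Lemma pcauchy_invE (x : pcauchy_seq) : x \notin pnull ->
  val (pcauchy_inv x) = (fun n => (val x n)^-1).
Proof.
move=> /pnull_away[c c0 [N hN]]; rewrite /pcauchy_inv insubdK //.
apply/pcauchyP => e e0.
have /pcauchyP/(_ (e * (c * c)))[|M hM] := valP x; first by rewrite !mulr_gt0.
exists (maxn N M) => i j; rewrite !geq_max => /andP[Ni Mi] /andP[Nj Mj].
have ci := hN _ Ni; have cj := hN _ Nj.
have xi : val x i != 0 by rewrite -rat_pabs_eq0 gt_eqF // (lt_le_trans c0).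
have xj : val x j != 0 by rewrite -rat_pabs_eq0 gt_eqF // (lt_le_trans c0).
have -> : (val x i)^-1 - (val x j)^-1 =
    (val x j - val x i) * (val x i * val x j)^-1 by field; rewrite xi xj.
rewrite rat_pabsM rat_pabsV ltr_pdivrMr; last first.
  by rewrite lt_neqAle rat_pabs_ge0 eq_sym rat_pabs_eq0 mulf_neq0.
apply: (@lt_le_trans _ _ (e * (c * c))); first exact: hM.
by rewrite rat_pabsM ler_pM2l // ler_pM // ltW.
Qed.

Definition Qp_inv (x : Qp) : Qp :=
  if x == 0 then 0 else \pi_Qp (pcauchy_inv (repr x)).

Lemma Qp_mulVf (x : Qp) : x != 0 -> Qp_inv x * x = 1.
Proof.
move=> x0; rewrite /Qp_inv (negbTE x0).
have nx : repr x \notin pnull.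
  apply: contra x0 => nx.
  by rewrite -[x]reprK piE Quotient.equivE subr0.
rewrite -[X in _ * X = _]reprK; apply/eqP; rewrite piE Quotient.equivE.
have [c c0 [N hN]] := pnull_away nx.
apply/pnullP => e e0; exists N => i Ni.
have xi : val (repr x) i != 0.
  by rewrite -rat_pabs_eq0 gt_eqF // (lt_le_trans c0) ?hN.
rewrite /= pcauchy_invE //.
by rewrite !fctE /= mulVf // subrr rat_pabs0.
Qed.

Lemma Qp_inv0 : Qp_inv 0 = 0. Proof. by rewrite /Qp_inv eqxx. Qed.

HB.instance Definition _ := GRing.ComNzRing_isField.Build Qp Qp_mulVf Qp_inv0.

(* rat_pabs p is eventually constant along a non-null Cauchy sequence, so this
   limit always exists and does not depend on the representative. *)
Definition pabs (R : realType) (x : Qp) : R :=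
  lim ((ratr (rat_pabs p (val (repr x) n)) : R) @[n --> \oo]).

End RatPabs.

Section Conjugacy.
Variables (R : realType) (S T : Type).

Definition isometrically_conjugate
    (X : set S) (F : S -> S) (dX : S -> S -> R)
    (Y : set T) (G : T -> T) (dY : T -> T -> R) : Prop :=
  [/\ F @` X `<=` X, G @` Y `<=` Y &
      exists h : S -> T,
        [/\ set_bij X Y h,
            forall x y, X x -> X y -> dY (h x) (h y) = dX x y &
            forall x, X x -> h (F x) = G (h x)]].

End Conjugacy.

Definition topologically_conjugate (S T : topologicalType)
    (X : set S) (F : S -> S) (Y : set T) (G : T -> T) : Prop :=
  [/\ F @` X `<=` X, G @` Y `<=` Y &
      exists (h : S -> T) (g : T -> S),
        [/\ h @` X `<=` Y /\ g @` Y `<=` X,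
            (forall x, X x -> g (h x) = x) /\ (forall y, Y y -> h (g y) = y),
            {within X, continuous h}, {within Y, continuous g} &
            forall x, X x -> h (F x) = G (h x)]].

Definition irreducible_mx (n : nat) (A : 'M[nat]_n.+1) : Prop :=
  forall i j, exists2 k : nat, (0 < k)%N & (0 < (A ^+ k) i j)%N.

Section Symbolic.
Variable n : nat.

Definition symb_seq : topologicalType :=
  prod_topology (fun _ : nat => discrete_topology 'I_n).

Definition left_shift (x : symb_seq) : symb_seq := fun k => x k.+1.

Definition subshift (A : 'M[nat]_n) : set symb_seq :=
  [set x | forall k, A (x k) (x k.+1) = 1%N].

Definition first_diff (x y : symb_seq) : nat :=
  xget 0%N [set k | x k <> y k /\ forall j, (j < k)%N -> x j = y j].

Definition symb_dist (R : realType) (p : nat) (tau : 'I_n -> int)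
    (kappa : 'I_n -> 'I_n -> int) (x y : symb_seq) : R :=
  if `[< x = y >] then 0
  else let k := first_diff x y in
    p%:R ^ (- (\sum_(j < k) tau (x j)) - kappa (x k) (y k)).

End Symbolic.

(* Rows and columns are numbered from 0. Row i < m carries the blocks
   (e_1^T, I_m, 0^T, 0^T): the block I_m occupies the columns 1, ..., m. *)
Definition potts_mx (m : nat) : 'M[nat]_m.+3 :=
  \matrix_(i, j)
    ((if (i < m)%N then ((i == 0%N :> nat) && (j == 0%N :> nat)) || (j == i.+1 :> nat)
     else if i == m :> nat then (m < j)%N
     else true) : nat).

Section PottsBethe.
Variables (R : realType) (p : nat) (hp : prime p).
Local Notation K := (Qp hp).
Local Notation abs := (@pabs p hp R).

Definition pball (rho : R) (a : K) : set K := [set x | abs (x - a) < rho].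

Definition unit_disk_E : set K :=
  [set x | abs (x - 1) < p%:R `^ (- (1 / (p%:R - 1)))].

(* The k such that z = p ^ k, for z a power of p. *)
Definition pexponent (z : R) : int := xget 0 [set k : int | z = p%:R ^ k].

Section Map.
Variables theta q : K.

Definition xinf : K := 2 - theta - q.

(* Division being total, potts_bethe xinf is a junk value; every notion below
   excludes the orbits through xinf. *)
Definition potts_bethe (x : K) : K :=
  ((theta * x + q - 1) / (x + theta + q - 2)) ^+ 3.

Local Notation f := potts_bethe.

Definition iter_defined (n : nat) (x : K) : Prop :=
  forall k, (k < n)%N -> iter k f x <> xinf.

Definition iter_preimage (n : nat) (S : set K) : set K :=
  [set x | iter_defined n x /\ S (iter n f x)].

Definition iter_image (n : nat) (S : set K) : set K :=
  [set iter n f x | x in [set x | S x /\ iter_defined n x]].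

Definition basin (x0 : K) : set K :=
  [set x | (forall n, iter_defined n x) /\
           abs (iter n f x - x0) @[n --> \oo] --> (0 : R)].

Definition potts_cubic : {poly K} :=
  'X^3 - (1 + theta + theta ^+ 2)%:P * 'X^2
  - ((2 * theta + 1) * (1 - theta - q))%:P * 'X
  - ((1 - theta - q) ^+ 2)%:P.

Definition labelled_roots (y1 y2 y3 : K) : Prop :=
  [/\ potts_cubic = ('X - y1%:P) * ('X - y2%:P) * ('X - y3%:P),
      abs y1 = 1, abs y2 < 1, abs y2 = abs y3 &
      abs y3 = abs (1 - theta - q)].

Definition xfix (y : K) : K := 1 - q + (theta - 1) * (y - 1).

Definition radius : R := abs q * abs (theta - 1).

Section Pieces.
Variables (y1 y2 y3 : K) (m : nat).

Definition piece_D : set K := pball radius (xfix y1).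

Definition piece_C (y : K) : set K :=
  [set x | abs (x - xfix y) < abs (x - xinf) /\ abs (x - xinf) = radius].

Definition sphere_G (l : nat) : set K :=
  [set x | abs (x - xfix y1) = abs (theta - 1) ^+ l.+1 / abs q ^+ l].

Definition piece_H (l : nat) : set K :=
  xget set0 [set S | [/\ exists a, S = pball radius a,
                         S `<=` sphere_G l &
                         piece_C y2 `|` piece_C y3 `<=` iter_image l S]].

Definition XX : set K :=
  piece_D `|` \bigcup_(l in [set l | (1 <= l <= m)%N]) piece_H l
  `|` piece_C y2 `|` piece_C y3.

Definition JJ : set K := \bigcap_n iter_preimage n XX.

(* The order D_1, H_m, ..., H_1, C_2, C_3. *)
Definition piece (i : 'I_m.+3) : set K :=
  if i == 0%N :> nat then piece_D
  else if (i <= m)%N then piece_H (m.+1 - i)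
  else if i == m.+1 :> nat then piece_C y2
  else piece_C y3.

Definition incidence_mx : 'M[nat]_m.+3 :=
  \matrix_(i, j) (`[< piece j `<=` iter_image 1 (piece i) >] : nat).

Definition tau (i : 'I_m.+3) : int :=
  pexponent (if (i <= m)%N then abs q / abs (theta - 1)
             else 1 / (abs q * abs (theta - 1))).

Definition center (i : 'I_m.+3) : K :=
  xget 0 [set a | piece i = pball radius a].

Definition kappa (i j : 'I_m.+3) : int :=
  - pexponent (abs (center i - center j)).

Definition d_f : symb_seq m.+3 -> symb_seq m.+3 -> R := symb_dist R p tau kappa.

End Pieces.
End Map.
End PottsBethe.

(* Main.v *)
(* With c = 1 - theta - q and xi = xinf, the map is f x = (theta + e / (x - xi)) ^ 3
   where e = (theta - 1) c has absolute value the radius r. Where the Moebius part is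
   a unit, cubing is an isometry onto small balls (Hensel, as |3| = 1), so f scales
   distances by r / |x - xi| ^ 2 there: by 1 / lam with lam = |theta - 1| / |q| near x^(1)
   and by 1 / r on C_2 and C_3.

   Let a 0 = x^(2) and let a (l + 1) be the preimage of a l near x^(1); then
   |a l - x^(1)| = |theta - 1| lam ^ l, H_l is the ball of radius r around a l, and
   a (m + 1) already lies in D_1. Hence f expands the pieces in a Markov way with
   transition matrix A_m, and completeness makes the coding bijective. For the
   decomposition, a point with |x - xi| > |theta - 1| is sent to |y - 1| < |q|, where f
   contracts to 1, and every point outside the pieces is eventually as far as that
   from xi. *)
Require Import Defs.
From HB Require Import structures.
From mathcomp Require Import all_boot all_order all_algebra.
From mathcomp Require Import all_classical all_reals all_analysis.
From mathcomp Require Import finfield.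
From mathcomp Require Import zify ring.
Import Order.TTheory GRing.Theory Num.Theory.
Import numFieldNormedType.Exports.
Local Open Scope classical_set_scope.
Local Open Scope ring_scope.

Set Implicit Arguments.
Unset Strict Implicit.
Unset Printing Implicit Defensive.

(** * The absolute value of the p-adic numbers *)

Section PadicField.
Local Open Scope quotient_scope.

Variables (R : realType) (p : nat) (hp : prime p).
Local Notation K := (Qp hp).
Local Notation abs := (@pabs p hp R).
Local Notation Pnull := (@pnull p hp).
Implicit Types (s t : pcauchy_seq hp) (x y z : K).

(** Since |c| = |q|, the hypothesis on the exponents amounts to [lam ^ (m + 1) < |c| <= lam ^ m].
    Multiplied by |theta - 1|, it compares |a l - x^(1)| with r: [a l] stays outside D_1 exactly for
    l <= m, which is why there are m balls H_l. The same window shapes A_m. The image of D_1 or H_l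
    is a ball of radius r / lam = |c|^2, small enough to contain a single piece, with two
    exceptions: f(D_1) contains D_1 and H_m, and f(H_1) contains C_2 and C_3, which are r < |c|^2
    apart. The images of C_2 and C_3 are balls of radius 1 and contain every piece.

    The congruence p = 1 mod 3 enters through a primitive cube root of unity modulo p. It places the
    two small roots of the cubic in Q_p. Moreover the Moebius part sends x^(2) and x^(3) to elements
    reducing to the two primitive cube roots of unity, so C_2 and C_3 are the only parts of the
    sphere |x - xi| = r that are not thrown away from xi at once.

    The balls H_l and the centers defining kappa are given by choice operators, so uniqueness of the
    former and independence of the latter have to be established. *)

Let seqv s : nat -> rat := val s.

Lemma Qp_pi_eq0 s : (\pi_K s == 0) = (s \in Pnull).
Proof. by rewrite piE Quotient.equivE subr0. Qed.

Lemma Qp_pi_eq s t : (\pi_K s == \pi_K t) = (s - t \in Pnull).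
Proof. by rewrite piE Quotient.equivE. Qed.

Lemma rat_pabsD_dom (a b : rat) : rat_pabs p a < rat_pabs p b ->
  rat_pabs p (a + b) = rat_pabs p b.
Proof.
move=> ab; apply/eqP; rewrite eq_le; apply/andP; split.
  by rewrite (le_trans (rat_pabsD hp a b)) // ge_max lexx (ltW ab).
rewrite leNgt; apply/negP => h.
have := rat_pabsD_lt hp h (_ : rat_pabs p (- a) < rat_pabs p b).
by rewrite rat_pabsN addrC addKr ltxx => /(_ ab).
Qed.

(** Once differences drop below a lower bound of |s i|, the ultrametric inequality freezes the
    absolute value. An arbitrary equivalent [t] is allowed because [pabs] is computed on the
    representative [repr], which need not be [s]. *)
Lemma pcauchy_pabs_stationary s : s \notin Pnull ->
  exists2 c : rat, 0 < c & forall t, s - t \in Pnull ->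
  exists N, forall i j, (N <= i)%N -> (N <= j)%N ->
    c <= rat_pabs p (seqv s i) /\
    rat_pabs p (seqv t i) = rat_pabs p (seqv s j).
Proof.
move=> /pnull_away[c c0 [N1 h1]]; exists c => // t /pnullP/(_ _ c0)[N2 h2].
have /pcauchyP/(_ _ c0)[N3 h3] := valP s.
exists (maxn N1 (maxn N2 N3)) => i j.
rewrite !geq_max => /and3P[i1 i2 i3] /and3P[j1 j2 j3]; split; first exact: h1.
have hj := h1 _ j1.
have tsj : rat_pabs p (seqv t i - seqv s j) < rat_pabs p (seqv s j).
  apply: lt_le_trans hj; rewrite -(subrK (seqv s i) (seqv t i)) -addrA.
  apply: (rat_pabsD_lt hp); last exact: h3.
  by rewrite rat_pabsB //; exact: h2.
by rewrite -(rat_pabsD_dom tsj) subrK.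
Qed.

Lemma pabs_pi s : s \notin Pnull ->
  exists N, forall i, (N <= i)%N -> abs (\pi_K s) = ratr (rat_pabs p (seqv s i)).
Proof.
move=> ns; have [c c0 /(_ (repr (\pi_K s)))] := pcauchy_pabs_stationary ns.
rewrite -Qp_pi_eq reprK eqxx => -[]// N hN.
exists N => i Ni; rewrite /pabs.
apply: (@lim_near_cst R^o); first by [].
by exists N => // j /= Nj; rewrite (hN j i Nj Ni).2.
Qed.

Lemma pabs0 : abs 0 = 0.
Proof.
have n0 : repr (0 : K) \in Pnull by rewrite -Qp_pi_eq0 reprK.
rewrite /pabs; apply: (@cvg_lim R^o) => //.
apply/cvgrPdist_lt => e e0.
have [d d0 de] : exists2 d : rat, 0 < d & ratr d < e.
  have [d] := rat_in_itvoo e0; rewrite in_itv /= => /andP[d0 de].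
  by exists d; rewrite // -(ltr0q R).
have /pnullP/(_ _ d0)[N hN] := n0.
exists N => // i /= Ni; rewrite sub0r normrN ger0_norm ?ler0q ?rat_pabs_ge0 //.
by apply: lt_trans de; rewrite ltr_rat hN.
Qed.

(* Every finite family of absolute values is computed on one common index of
   the representatives, so that the properties of [rat_pabs] transfer. *)
Lemma pabs_repr x : x != 0 ->
  exists N, forall i, (N <= i)%N -> abs x = ratr (rat_pabs p (seqv (repr x) i)).
Proof.
by move=> x0; rewrite -[in abs x](reprK x); apply: pabs_pi; rewrite -Qp_pi_eq0 reprK.
Qed.

Lemma pabs_gt0 x : x != 0 -> 0 < abs x.
Proof.
move=> x0; have nx : repr x \notin Pnull by rewrite -Qp_pi_eq0 reprK.
have [c c0 [N1 h1]] := pnull_away nx; have [N2 h2] := pabs_repr x0.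
rewrite (h2 (maxn N1 N2)) ?leq_maxr // ltr0q (lt_le_trans c0) //.
by apply: h1; rewrite leq_maxl.
Qed.

Lemma pabs_eq0 x : (abs x == 0) = (x == 0).
Proof.
by have [->|/pabs_gt0/gt_eqF->] := eqVneq x 0; rewrite // pabs0 eqxx.
Qed.

Lemma pabs_ge0 x : 0 <= abs x.
Proof. by have [->|/pabs_gt0/ltW] := eqVneq x 0; rewrite // pabs0. Qed.

Lemma pabs_expz x : x != 0 -> exists k : int, abs x = p%:R ^ k.
Proof.
move=> x0; have [N hN] := pabs_repr x0; have := pabs_gt0 x0.
rewrite (hN N) // /rat_pabs; case: ifP => _; first by rewrite rmorph0 ltxx.
by exists (- rat_pval p (seqv (repr x) N)); rewrite (fmorphXz (@ratr R)); rewrite rmorph_nat.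
Qed.

Lemma pabsM x y : abs (x * y) = abs x * abs y.
Proof.
have [->|x0] := eqVneq x 0; first by rewrite mul0r pabs0 mul0r.
have [->|y0] := eqVneq y 0; first by rewrite mulr0 pabs0 mulr0.
have [N1 h1] := pabs_repr x0; have [N2 h2] := pabs_repr y0.
have e : \pi_K (repr x * repr y) = x * y by rewrite rmorphM /= !reprK.
have [|N3] := @pabs_pi (repr x * repr y); first by rewrite -Qp_pi_eq0 e (mulf_neq0 x0 y0).
rewrite e => /(_ (maxn N1 (maxn N2 N3))) ->; last by rewrite !leq_max leqnn !orbT.
rewrite (h1 (maxn N1 (maxn N2 N3))) ?(h2 (maxn N1 (maxn N2 N3))) ?leq_max ?leqnn ?orbT //.
by rewrite -rmorphM -rat_pabsM.
Qed.

Lemma pabsD x y : abs (x + y) <= Num.max (abs x) (abs y).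
Proof.
have [->|x0] := eqVneq x 0; first by rewrite add0r le_max lexx orbT.
have [->|y0] := eqVneq y 0; first by rewrite addr0 le_max lexx.
have [->|z0] := eqVneq (x + y) 0; first by rewrite pabs0 le_max pabs_ge0.
have [N1 h1] := pabs_repr x0; have [N2 h2] := pabs_repr y0.
have e : \pi_K (repr x + repr y) = x + y by rewrite rmorphD /= !reprK.
have [|N3] := @pabs_pi (repr x + repr y); first by rewrite -Qp_pi_eq0 e.
rewrite e => /(_ (maxn N1 (maxn N2 N3))) ->; last by rewrite !leq_max leqnn !orbT.
rewrite (h1 (maxn N1 (maxn N2 N3))) ?(h2 (maxn N1 (maxn N2 N3))) ?leq_max ?leqnn ?orbT //.
by rewrite le_max !ler_rat -le_max; exact: rat_pabsD.
Qed.

Lemma pabsN x : abs (- x) = abs x.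
Proof.
have [->|x0] := eqVneq x 0; first by rewrite oppr0.
have [N1 h1] := pabs_repr x0.
have e : \pi_K (- repr x) = - x by rewrite rmorphN /= reprK.
have [|N2] := @pabs_pi (- repr x); first by rewrite -Qp_pi_eq0 e oppr_eq0.
rewrite e => /(_ (maxn N1 N2)) ->; last by rewrite leq_maxr.
by rewrite (h1 (maxn N1 N2)) ?leq_maxl // /seqv -(rat_pabsN p (val (repr x) _)).
Qed.

Lemma rat_cst_cauchy (a : rat) : (fun=> a) \in pcauchy hp.
Proof. by apply/pcauchyP => e e0; exists 0%N => i j _ _; rewrite subrr rat_pabs0. Qed.

Definition Qp_of_rat (a : rat) : K := \pi_K (Sub (fun=> a) (rat_cst_cauchy a) : pcauchy_seq hp).

(** A strict bound survives the passage to the limit because the limit value is attained at a finite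
    index. *)
Lemma seq_pabs_lt s (e : rat) : 0 < e ->
  (exists N, forall i, (N <= i)%N -> rat_pabs p (seqv s i) < e) -> abs (\pi_K s) < ratr e.
Proof.
move=> e0 [N h]; have [ns|ns] := boolP (s \in Pnull).
  by move: ns; rewrite -Qp_pi_eq0 => /eqP->; rewrite pabs0 ltr0q.
have [M hM] := pabs_pi ns.
by rewrite (hM (maxn M N)) ?leq_maxl // ltr_rat h // leq_maxr.
Qed.

Lemma pabs_Qp_of_rat (a : rat) : abs (Qp_of_rat a) = ratr (rat_pabs p a).
Proof.
have [na|na] := boolP ((Sub (fun=> a) (rat_cst_cauchy a) : pcauchy_seq hp) \in Pnull).
  have -> : a = 0.
    apply/eqP; rewrite -(rat_pabs_eq0 hp) -[_ == 0]negbK; apply/negP => a0.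
    have a1 : 0 < rat_pabs p a by rewrite lt_neqAle eq_sym a0 rat_pabs_ge0.
    by have /pnullP/(_ _ a1)[N /(_ N (leqnn N))] := na; rewrite SubK ltxx.
  rewrite rat_pabs0 rmorph0; apply/eqP; rewrite pabs_eq0 Qp_pi_eq0.
  by apply/pnullP => e e0; exists 0%N => i _; rewrite SubK rat_pabs0.
by have [N /(_ N (leqnn N))] := pabs_pi na; rewrite /seqv SubK.
Qed.

Lemma Qp_of_natr (n : nat) : Qp_of_rat n%:R = n%:R.
Proof.
have -> : (n%:R : K) = \pi_K (n%:R) by rewrite rmorph_nat.
apply/eqP; rewrite Qp_pi_eq; apply/pnullP => e e0; exists 0%N => i _.
suff -> : val ((Sub (fun=> n%:R) (rat_cst_cauchy n%:R) : pcauchy_seq hp) - n%:R) i = 0.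
  by rewrite rat_pabs0.
rewrite rmorphB /= !fctE -[val (n%:R)]/((val (n%:R : pcauchy_seq hp))) rmorph_nat.
suff -> : (n%:R : nat -> rat) i = n%:R by rewrite subrr.
by elim: n => // n IH; rewrite !mulrS !fctE IH.
Qed.

Lemma pabs_nat (n : nat) : (0 < n)%N -> ~~ (p %| n)%N -> abs n%:R = 1.
Proof.
move=> n0 pn; rewrite -Qp_of_natr pabs_Qp_of_rat /rat_pabs pnatr_eq0 (gtn_eqF n0).
rewrite /rat_pval -[n%:R]/(n%:Q) numq_int denq_int /= logn1 subr0.
have -> : logn p n = 0%N by rewrite lognE hp n0 (negbTE pn).
by rewrite oppr0 expr0z rmorph1.
Qed.

Lemma pabs_nat_lt1 (n : nat) : (p %| n)%N -> abs n%:R < 1.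
Proof.
have [->|n0] := posnP n; first by rewrite pabs0 ltr01.
move=> pn; rewrite -Qp_of_natr pabs_Qp_of_rat /rat_pabs pnatr_eq0 (gtn_eqF n0).
rewrite /rat_pval -[n%:R]/(n%:Q) numq_int denq_int /= logn1 subr0.
rewrite -(rmorph1 (@ratr R)) ltr_rat -[X in _ < X](expr0z (p%:R : rat)).
by rewrite ltr_eXz2l ?p_gt1 // oppr_lt0 ltz_nat logn_gt0 mem_primes hp n0.
Qed.

Lemma Qp_dense x (e : rat) : 0 < e -> exists a : rat, abs (x - Qp_of_rat a) < ratr e.
Proof.
rewrite -(reprK x); move: (repr x) => s {x} e0.
have /pcauchyP/(_ _ e0)[N hN] := valP s; exists (seqv s N); rewrite -rmorphB /=.
apply: seq_pabs_lt => //; exists N => i Ni.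
by rewrite /seqv rmorphB /= !fctE; exact: hN.
Qed.

Lemma ratr_lt (e : R) : 0 < e -> exists2 d : rat, 0 < d & ratr d < e.
Proof.
move=> e0; have [d] := rat_in_itvoo e0; rewrite in_itv /= => /andP[d0 de].
by exists d; rewrite // -(ltr0q R).
Qed.

Lemma pabsD_lt x y (e : R) : abs x < e -> abs y < e -> abs (x + y) < e.
Proof. by move=> h k; rewrite (le_lt_trans (pabsD x y)) // gt_max h. Qed.

(** Diagonal argument: rationals [a n] within 1/(n+1) of [u n] form a Cauchy sequence, whose class
    is the limit. *)
Lemma Qp_complete (u : nat -> K) :
  (forall e : R, 0 < e -> exists N, forall i j, (N <= i)%N -> (N <= j)%N ->
     abs (u i - u j) < e) ->
  exists l, forall e : R, 0 < e -> exists N, forall i, (N <= i)%N -> abs (u i - l) < e.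
Proof.
move=> cu; have d0 (n : nat) : 0 < n.+1%:R^-1 :> rat by rewrite invr_gt0 ltr0n.
have /choice[a ha] : forall n, exists a, abs (u n - Qp_of_rat a) < ratr n.+1%:R^-1.
  by move=> n; exact: Qp_dense.
have da (e : R) : 0 < e -> exists N, forall i, (N <= i)%N -> abs (u i - Qp_of_rat (a i)) < e.
  move=> e0; have [N hN] : exists N : nat, e^-1 < N%:R by exists (Num.truncn e^-1).+1; exact: truncnS_gt.
  exists N => i Ni; apply: lt_trans (ha i) _; rewrite fmorphV rmorph_nat -[e]invrK.
  rewrite ltf_pV2 ?posrE ?invr_gt0 ?ltr0n //; apply: lt_le_trans hN _.
  by rewrite ler_nat ltnW.
have ca : (a : nat -> rat) \in pcauchy hp.
  apply/pcauchyP => e e0; have e0' : 0 < ratr e :> R by rewrite ltr0q.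
  have [N1 h1] := cu _ e0'; have [N2 h2] := da _ e0'.
  exists (maxn N1 N2) => i j; rewrite !geq_max => /andP[i1 i2] /andP[j1 j2].
  rewrite -(ltr_rat R) -pabs_Qp_of_rat.
  have -> : Qp_of_rat (a i - a j) =
      - (u i - Qp_of_rat (a i)) + (u i - u j) + (u j - Qp_of_rat (a j)).
    have -> : Qp_of_rat (a i - a j) = Qp_of_rat (a i) - Qp_of_rat (a j).
      apply/eqP; rewrite -rmorphB /= Qp_pi_eq; apply/pnullP => d d1; exists 0%N => k _.
      by rewrite !rmorphB /= !fctE subrr rat_pabs0.
    ring.
  by apply: pabsD_lt; [apply: pabsD_lt; [rewrite pabsN; exact: h2|exact: h1]|exact: h2].
exists (\pi_K (Sub a ca : pcauchy_seq hp)) => e e0.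
have [d d1 de] := ratr_lt e0; have d1' : 0 < ratr d :> R by rewrite ltr0q.
have [N1 h1] := da _ d1'; have /pcauchyP/(_ _ d1)[N2 h2] := ca.
exists (maxn N1 N2) => i; rewrite !geq_max => /andP[i1 i2].
rewrite -(subrK (Qp_of_rat (a i)) (u i)) -addrA; apply: lt_trans de.
apply: pabsD_lt; first exact: h1.
rewrite -rmorphB /=; apply: seq_pabs_lt => //; exists N2 => k Nk.
by rewrite /seqv rmorphB /= !fctE; exact: h2.
Qed.

End PadicField.

(** * Ultrametric estimates and Hensel's lemma *)

(* The later arguments only use these properties of [Qp hp]; stating them for an
   abstract field keeps the quotient construction out of the way of conversion. *)
Record padic_abs (R : realType) (p : nat) (K : fieldType) (abs : K -> R) : Prop := PadicAbs {
  padic_prime : prime p;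
  padic_abs0 : abs 0 = 0;
  padic_abs_gt0 : forall x, x != 0 -> 0 < abs x;
  padic_absM : forall x y, abs (x * y) = abs x * abs y;
  padic_absD : forall x y, abs (x + y) <= Num.max (abs x) (abs y);
  padic_absN : forall x, abs (- x) = abs x;
  padic_abs_expz : forall x, x != 0 -> exists k : int, abs x = p%:R ^ k;
  padic_abs_nat : forall n, (0 < n)%N -> ~~ (p %| n)%N -> abs n%:R = 1;
  padic_abs_nat_lt1 : forall n, (p %| n)%N -> abs n%:R < 1;
  padic_complete : forall u : nat -> K,
    (forall e : R, 0 < e -> exists N, forall i j, (N <= i)%N -> (N <= j)%N ->
       abs (u i - u j) < e) ->
    exists l, forall e : R, 0 < e -> exists N, forall i, (N <= i)%N -> abs (u i - l) < e }.

Lemma pabs_padic (R : realType) (p : nat) (hp : prime p) : padic_abs p (@pabs p hp R).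
Proof.
split.
- exact: hp.
- exact: pabs0.
- exact: pabs_gt0.
- exact: pabsM.
- exact: pabsD.
- exact: pabsN.
- exact: pabs_expz.
- exact: pabs_nat.
- exact: pabs_nat_lt1.
- exact: Qp_complete.
Qed.

Section Ultrametric.

Variables (R : realType) (p : nat) (K : fieldType) (abs : K -> R).
Hypothesis K_padic : padic_abs p abs.
Implicit Types (x y z a b d : K) (e : R).

Let hp := padic_prime K_padic.
Let pabs0 := padic_abs0 K_padic.
Let pabs_gt0 := padic_abs_gt0 K_padic.
Let pabsM := padic_absM K_padic.
Let pabsN := padic_absN K_padic.
Let pabs_expz := padic_abs_expz K_padic.

Lemma abs_eq0 x : (abs x == 0) = (x == 0).
Proof. by have [->|/pabs_gt0/gt_eqF->] := eqVneq x 0; rewrite // pabs0 eqxx. Qed.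

Lemma abs_ge0 x : 0 <= abs x.
Proof. by have [->|/pabs_gt0/ltW] := eqVneq x 0; rewrite // pabs0. Qed.

Lemma abs1 : abs 1 = 1.
Proof.
by rewrite -[1]/(1%:R) (padic_abs_nat K_padic) // dvdn1 neq_ltn prime_gt1 // orbT.
Qed.

Lemma absD_lt x y e : abs x < e -> abs y < e -> abs (x + y) < e.
Proof. by move=> h k; rewrite (le_lt_trans (padic_absD K_padic x y)) // gt_max h. Qed.

Lemma absX x n : abs (x ^+ n) = abs x ^+ n.
Proof. by elim: n => [|n IH]; rewrite ?abs1 // !exprS pabsM IH. Qed.

Lemma absV x : abs x^-1 = (abs x)^-1.
Proof.
have [->|x0] := eqVneq x 0; first by rewrite invr0 pabs0 invr0.
apply: (@mulfI _ (abs x)); first by rewrite abs_eq0.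
by rewrite -pabsM !divff ?abs1 ?abs_eq0.
Qed.

Lemma abs_div x y : abs (x / y) = abs x / abs y.
Proof. by rewrite pabsM absV. Qed.

Lemma abs_distC x y : abs (x - y) = abs (y - x).
Proof. by rewrite -pabsN opprB. Qed.

Lemma absD_le x y e : abs x <= e -> abs y <= e -> abs (x + y) <= e.
Proof. by move=> h k; rewrite (le_trans (padic_absD K_padic x y)) // ge_max h. Qed.

Lemma absB_lt x y e : abs x < e -> abs y < e -> abs (x - y) < e.
Proof. by move=> h k; apply: absD_lt; rewrite ?pabsN. Qed.

Lemma abs_trans_lt y x z e : abs (x - y) < e -> abs (y - z) < e -> abs (x - z) < e.
Proof. by move=> h k; rewrite -(subrK y x) -addrA absD_lt. Qed.

Lemma abs_trans_le y x z e : abs (x - y) <= e -> abs (y - z) <= e -> abs (x - z) <= e.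
Proof. by move=> h k; rewrite -(subrK y x) -addrA absD_le. Qed.

Lemma absD_dom x y : abs y < abs x -> abs (x + y) = abs x.
Proof.
move=> yx; apply/eqP; rewrite eq_le absD_le ?(ltW yx) //= leNgt; apply/negP => h.
by have := absB_lt h yx; rewrite addrK ltxx.
Qed.

Lemma absB_dom x y : abs y < abs x -> abs (x - y) = abs x.
Proof. by move=> yx; rewrite absD_dom ?pabsN. Qed.

Lemma absB_doml x y : abs x < abs y -> abs (x - y) = abs y.
Proof. by move=> yx; rewrite abs_distC absB_dom. Qed.

Lemma abs_close x y : abs (x - y) < abs y -> abs x = abs y.
Proof. by move=> h; rewrite -(subrK y x) addrC absD_dom. Qed.

Lemma abs_close_dist x y z : abs (x - y) < abs (y - z) -> abs (x - z) = abs (y - z).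
Proof. by move=> h; apply: abs_close; rewrite opprB addrA subrK. Qed.

Lemma primeR_gt1 : 1 < p%:R :> R.
Proof. by rewrite ltr1n prime_gt1. Qed.

Lemma primeR_gt0 : 0 < p%:R :> R.
Proof. exact: lt_trans primeR_gt1. Qed.

(* The value group is discrete, so strict inequalities gain a factor [p]. *)
Lemma abs_lt_div x y : abs x < abs y -> abs x <= abs y / p%:R.
Proof.
have [->|x0] := eqVneq x 0; first by rewrite pabs0 divr_ge0 ?abs_ge0 ?(ltW primeR_gt0).
have [->|y0] := eqVneq y 0; first by rewrite pabs0 ltNge abs_ge0.
have [k ->] := pabs_expz x0; have [l ->] := pabs_expz y0.
rewrite ltr_eXz2l ?primeR_gt1 // => kl.
rewrite ler_pdivlMr ?primeR_gt0 // -[X in _ * X]expr1z.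
by rewrite -expfzDr ?gt_eqF ?primeR_gt0 // ler_eXz2l ?primeR_gt1 //; lia.
Qed.

Lemma abs_eq0P x : (forall e, 0 < e -> abs x < e) -> x = 0.
Proof.
by move=> h; apply/eqP; apply: contraT => /(pabs_gt0) x0; have := h _ x0; rewrite ltxx.
Qed.

Lemma geometric_small (C e : R) : 0 < e -> exists n, C / p%:R ^+ n < e.
Proof.
move=> e0; exists (Num.truncn (C / e)).+1; rewrite ltr_pdivrMr ?exprn_gt0 ?primeR_gt0 //.
rewrite mulrC -ltr_pdivrMr //; apply: lt_trans (truncnS_gt _) _.
by rewrite -natrX ltr_nat ltn_expl // prime_gt1.
Qed.

(** The rate passes to the limit without loss: if [u n] were farther from [l] than the bound, a late
    term would be closer to both of them than they are to each other. *)
Lemma geometric_cvg (u : nat -> K) (C : R) :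
  (forall n, abs (u n.+1 - u n) <= C / p%:R ^+ n) ->
  exists l, forall n, abs (u n - l) <= C / p%:R ^+ n.
Proof.
move=> hu; have C0 : 0 <= C.
  by have := hu 0%N; rewrite expr0 divr1; apply: le_trans; exact: abs_ge0.
have dec i k : C / p%:R ^+ (i + k) <= C / p%:R ^+ i.
  rewrite ler_wpM2l // lef_pV2 ?posrE ?exprn_gt0 ?primeR_gt0 //.
  by rewrite ler_eXn2l ?primeR_gt1 // leq_addr.
have cl i k : abs (u (i + k)%N - u i) <= C / p%:R ^+ i.
  elim: k => [|k IH].
    by rewrite addn0 subrr pabs0 divr_ge0 // exprn_ge0 // ltW // primeR_gt0.
  by rewrite addnS; apply: abs_trans_le IH; apply: le_trans (hu _) _.
have [e e0|l hl] := padic_complete K_padic (u := u).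
  have [N hN] := geometric_small C e0; exists N => i j Ni Nj.
  rewrite -(subnKC Ni) -(subnKC Nj); apply: (@abs_trans_lt (u N)).
    exact: le_lt_trans (cl _ _) hN.
  by rewrite abs_distC; exact: le_lt_trans (cl _ _) hN.
exists l => n; rewrite leNgt; apply/negP => h.
have n0 : 0 < abs (u n - l).
  by apply: le_lt_trans h; rewrite divr_ge0 // exprn_ge0 // ltW // primeR_gt0.
have [N /(_ (n + N)%N (leq_addl _ _)) hN] := hl _ n0.
have : abs (u n - l) < abs (u n - l).
  apply: (@abs_trans_lt (u (n + N)%N)) => //.
  by rewrite abs_distC; exact: le_lt_trans (cl _ _) h.
by rewrite ltxx.
Qed.

(* Newton iteration with the constant slope [d]. *)
Lemma hensel (F : K -> K) (a d b : K) (rho : R) :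
  (forall x y, abs (x - a) < rho -> abs (y - a) < rho -> x != y ->
     abs (F x - F y - d * (x - y)) < abs d * abs (x - y)) ->
  d != 0 -> abs (b - F a) < abs d * rho ->
  exists2 x, abs (x - a) < rho & F x = b.
Proof.
move=> hF d0 hb; have d1 := pabs_gt0 d0.
pose u := fix u n := if n is k.+1 then u k + (b - F (u k)) / d else a.
have uS n : u n.+1 - u n = (b - F (u n)) / d by rewrite /= addrAC subrr add0r.
have rho0 : 0 < rho by rewrite -(pmulr_rgt0 _ d1) (le_lt_trans _ hb) ?abs_ge0.
(* The new residual is the linearization error of the step just made. It is strictly smaller than
   the old residual, hence smaller by a factor [p] by discreteness. *)
have eE n : b - F (u n.+1) = - (F (u n.+1) - F (u n) - d * (u n.+1 - u n)).
  by rewrite uS; field.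
have ball0 : abs (a - a) < rho by rewrite subrr pabs0.
have step n : abs (u n - a) < rho /\ abs (b - F (u n)) <= abs (b - F a) / p%:R ^+ n.
  elim: n => [|n [IH1 IH2]]; first by rewrite expr0 divr1.
  have le0 : abs (b - F (u n)) <= abs (b - F a).
    apply: le_trans IH2 _; rewrite ler_pdivrMr ?exprn_gt0 ?primeR_gt0 //.
    by rewrite ler_peMr ?abs_ge0 // exprn_ege1 // ltW // primeR_gt1.
  have b1 : abs (u n.+1 - a) < rho.
    apply: abs_trans_lt IH1; rewrite uS abs_div ltr_pdivrMr // mulrC.
    exact: le_lt_trans le0 hb.
  split=> //; have [e|ne] := eqVneq (u n.+1) (u n).
    by rewrite eE e !subrr mulr0 subrr oppr0 pabs0 divr_ge0 ?abs_ge0 ?exprn_ge0 ?(ltW primeR_gt0).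
  have := hF _ _ b1 IH1 ne; rewrite -pabsN -eE -pabsM => /abs_lt_div h.
  apply: le_trans h _; rewrite [d * _](_ : _ = b - F (u n)); last by rewrite uS mulrC divfK.
  rewrite exprSr invfM mulrA.
  by rewrite ler_wpM2r // invr_ge0 ltW // primeR_gt0.
have [n|l hl] := @geometric_cvg u (abs (b - F a) / abs d).
  rewrite uS abs_div mulrAC ler_wpM2r ?invr_ge0 ?abs_ge0 //.
  exact: (step n).2.
have hla : abs (l - a) < rho.
  have := hl 0%N; rewrite expr0 divr1 /= abs_distC => /le_lt_trans; apply.
  by rewrite ltr_pdivrMr // mulrC.
exists l => //; apply/eqP; rewrite eq_sym -subr_eq0; apply/eqP; apply: abs_eq0P => e e0.
have [n hn] := geometric_small (abs (b - F a)) e0.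
apply: (@abs_trans_lt (F (u n))); first exact: le_lt_trans (step n).2 hn.
have [->|ne] := eqVneq (u n) l; first by rewrite subrr pabs0.
rewrite (@abs_close _ (d * (u n - l))); last by rewrite [in X in _ < X]pabsM; apply: hF => //; exact: (step n).1.
rewrite pabsM mulrC -ltr_pdivlMr //; apply: le_lt_trans (hl n) _.
by rewrite mulrAC ltr_pM2r ?invr_gt0.
Qed.

Lemma hensel_isometry (F : K -> K) (a d : K) (rho : R) :
  (forall x y, abs (x - a) < rho -> abs (y - a) < rho -> x != y ->
     abs (F x - F y - d * (x - y)) < abs d * abs (x - y)) ->
  forall x y, abs (x - a) < rho -> abs (y - a) < rho ->
  abs (F x - F y) = abs d * abs (x - y).
Proof.
move=> hF x y hx hy; have [->|ne] := eqVneq x y; first by rewrite !subrr pabs0 mulr0.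
by rewrite -pabsM; apply: abs_close; rewrite [in X in _ < X]pabsM; apply: hF.
Qed.

End Ultrametric.

(** * Cubes and the roots of the Potts cubic *)

(** With k = (p - 1) / 3, the polynomial X^k - 1 has too few roots to vanish on all nonzero
    residues. If x is not a root, then x^k is a cube root of unity other than 1. *)
Lemma dvd_prime_omega (p : nat) : prime p -> (p = 1 %[mod 3])%N ->
  exists n : nat, (p %| n ^ 2 + n + 1)%N.
Proof.
move=> hp hp3; have p7 : (3 < p)%N.
  by case: p hp hp3 => [|[|[|[|p]]]].
pose k := (p.-1 %/ 3)%N; have pk : (p.-1 = k * 3)%N.
  by rewrite /k divnK //; move: hp3 p7; clear; lia.
have k0 : (0 < k)%N by lia.
have [x x0 xk] : exists2 x : 'F_p, x != 0 & x ^+ k != 1.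
  apply: contrapT => H; pose rs := [seq x <- enum 'F_p | x != 0].
  have hrs : all (root ('X^k - 1%:P : {poly 'F_p})) rs.
    apply/allP => x; rewrite mem_filter => /andP[x0 _].
    rewrite /root !hornerE subr_eq0; apply: contrapT => /negP xk.
    by apply: H; exists x.
  have P0 : 'X^k - 1%:P != 0 :> {poly 'F_p}.
    by rewrite -size_poly_eq0 size_XnsubC.
  have := max_poly_roots P0 hrs (filter_uniq _ (enum_uniq _)).
  rewrite size_XnsubC // size_filter.
  have := count_predC (pred1 (0 : 'F_p)) (enum 'F_p).
  have -> : count (pred1 (0 : 'F_p)) (enum 'F_p) = 1%N.
    by rewrite -/(count_mem 0 _) count_uniq_mem ?enum_uniq // mem_enum.
  rewrite -cardE card_Fp // -/(predC _) (eq_count (a2 := predC (pred1 (0 : 'F_p)))) //.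
  by move: pk; move: (count _ _) => c; lia.
have y3 : (x ^+ k) ^+ 3 = 1.
  have ep : p = (k * 3).+1 by rewrite -pk prednK // prime_gt0.
  have := expf_card x; rewrite card_Fp // [X in x ^+ X = _ -> _]ep exprS exprM.
  by rewrite -[X in _ = X]mulr1 => /(mulfI x0).
move: (x ^+ k) xk y3 => y y1 y3; exists (val y).
rewrite (dvdn_pcharf (pchar_Fp hp)) !natrD natrX natr_Zp.
have : (y - 1) * (y ^+ 2 + y + 1) = 0 by rewrite -[RHS](subrr 1) -[X in _ = X - _]y3; ring.
by move=> /eqP; rewrite mulf_eq0 subr_eq0 (negbTE y1).
Qed.

Section Cubes.
Variables (R : realType) (p : nat) (K : fieldType) (abs : K -> R).
Hypothesis K_padic : padic_abs p abs.
Hypothesis hp3 : (p = 1 %[mod 3])%N.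
Implicit Types (x y z w : K).

Let hp := padic_prime K_padic.

Lemma absM_lt1l x y : abs x <= 1 -> abs y < 1 -> abs (x * y) < 1.
Proof.
move=> hx hy; rewrite (padic_absM K_padic) (le_lt_trans _ hy) //.
by rewrite ler_piMl // (abs_ge0 K_padic).
Qed.

Lemma absM_lt1r x y : abs x < 1 -> abs y <= 1 -> abs (x * y) < 1.
Proof. by move=> hx hy; rewrite mulrC absM_lt1l. Qed.

Lemma absM_le1 x y : abs x <= 1 -> abs y <= 1 -> abs (x * y) <= 1.
Proof.
by move=> hx hy; rewrite (padic_absM K_padic) mulr_ile1 // (abs_ge0 K_padic).
Qed.

Lemma abs_nat_le1 n : abs n%:R <= 1.
Proof.
have [/(padic_abs_nat_lt1 K_padic)/ltW//|pn] := boolP (p %| n)%N.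
case: n pn => [|n pn]; first by rewrite dvdn0.
by rewrite (padic_abs_nat K_padic).
Qed.

Lemma absX_le1 x n : abs x <= 1 -> abs (x ^+ n) <= 1.
Proof. by move=> hx; rewrite (absX K_padic) exprn_ile1 // (abs_ge0 K_padic). Qed.

Lemma absX_lt1 x n : abs x < 1 -> abs (x ^+ n.+1) < 1.
Proof. by move=> hx; rewrite (absX K_padic) exprn_ilt1 // (abs_ge0 K_padic). Qed.

Lemma abs2 : abs 2 = 1.
Proof.
apply: (padic_abs_nat K_padic) => //; apply/negP => /dvdn_leq -/(_ isT) h.
by move: (prime_gt1 hp) h hp3; case: (p) => [|[|[|]]].
Qed.

Lemma abs3 : abs 3 = 1.
Proof.
apply: (padic_abs_nat K_padic) => //; apply/negP => /dvdn_leq -/(_ isT) h.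
by move: (prime_gt1 hp) h hp3; case: (p) => [|[|[|[|]]]].
Qed.

(** Membership in the valuation ring by recursion on the expression; [small] does the same for the
    maximal ideal. Hensel estimates then only need an identity exhibiting a small factor in each
    term. *)
Ltac integral := solve [assumption | apply: ltW; assumption
  | match goal with H : abs ?x = 1 |- is_true (abs ?x <= 1) => by rewrite H end
  | exact: abs_nat_le1
  | by rewrite (abs1 K_padic)
  | by rewrite (padic_absN K_padic); integral
  | apply: (absD_le K_padic); integral
  | apply: absM_le1; integral
  | apply: absX_le1; integral].

Ltac small := solve [assumption
  | by rewrite (padic_absN K_padic); small
  | apply: (absD_lt K_padic); small
  | apply: absM_lt1l; [integral | small]
  | apply: absM_lt1r; [small | integral]
  | apply: absX_lt1; small].

Lemma abs_int_close w x : abs w <= 1 -> abs (x - w) < 1 -> abs x <= 1.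
Proof. by move=> hw hx; rewrite -(subrK w x); integral. Qed.

Lemma cube_slope_neq0 w : abs w = 1 -> abs (3 * w ^+ 2) = 1.
Proof. by move=> hw; rewrite (padic_absM K_padic) (absX K_padic) hw abs3 expr1n mulr1. Qed.

Lemma cube_slope w : abs w = 1 -> forall x y, abs (x - w) < 1 -> abs (y - w) < 1 ->
  x != y -> abs (x ^+ 3 - y ^+ 3 - 3 * w ^+ 2 * (x - y)) < abs (3 * w ^+ 2) * abs (x - y).
Proof.
move=> hw x y hx hy xy; have w1 : abs w <= 1 by rewrite hw.
have x1 := abs_int_close w1 hx; have y1 := abs_int_close w1 hy.
(* The cofactor x^2 + x y + y^2 - 3 w^2 is spread over terms that each contain x - w or y - w. *)
rewrite (_ : _ - _ = (x - y) * ((x - w) * (x + w) + (x - w) * y + w * (y - w) +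
    (y - w) * (y + w))); last by ring.
rewrite (padic_absM K_padic) cube_slope_neq0 // mul1r.
rewrite gtr_pMr ?(padic_abs_gt0 K_padic) ?subr_eq0 //.
by small.
Qed.

Lemma cube_dist w x y : abs w = 1 -> abs (x - w) < 1 -> abs (y - w) < 1 ->
  abs (x ^+ 3 - y ^+ 3) = abs (x - y).
Proof.
move=> hw hx hy; rewrite (hensel_isometry K_padic (cube_slope hw)) //.
by rewrite cube_slope_neq0 // mul1r.
Qed.

Lemma cube_onto w b (rho : R) : abs w = 1 -> rho <= 1 -> abs (b - w ^+ 3) < rho ->
  exists2 x, abs (x - w) < rho & x ^+ 3 = b.
Proof.
move=> hw hrho hb; apply: (@hensel _ _ _ _ K_padic (fun x => x ^+ 3) w (3 * w ^+ 2)).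
- move=> x y hx hy; apply: cube_slope => //; exact: lt_le_trans hrho.
- by rewrite -(abs_eq0 K_padic) cube_slope_neq0 // oner_eq0.
- by rewrite cube_slope_neq0 // mul1r.
Qed.

Lemma cube_dist1 w : abs (w - 1) < 1 -> abs (w ^+ 3 - 1) = abs (w - 1).
Proof.
move=> hw; rewrite -[in LHS](expr1n K 3); apply: (cube_dist (abs1 K_padic)) => //.
by rewrite subrr (padic_abs0 K_padic).
Qed.

(** * The three roots of the Potts cubic and their mutual distances *)

Section Roots.
Variables (theta c : K).
Hypotheses (theta1 : abs (theta - 1) < 1) (c0 : c != 0) (c1 : abs c < 1).
Local Notation S := (1 + theta + theta ^+ 2).
Local Notation P := ((2 * theta + 1) * c).
Local Notation cubic y := (y ^+ 3 - S * y ^+ 2 - P * y - c ^+ 2).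

Let theta_le1 : abs theta <= 1.
Proof. by apply: abs_int_close theta1; rewrite (abs1 K_padic). Qed.

(** As theta reduces to 1 and c to 0, the cubic reduces to y^3 - 3 y^2, with simple root 3 and slope
    9 there. *)
Lemma cubic_root1 : exists2 y, abs y = 1 & cubic y = 0.
Proof.
have h9 : abs 9 = 1.
  by rewrite (_ : 9 = 3 * 3) ?(padic_absM K_padic) ?abs3 ?mulr1 //; ring.
have [|||y hy e] := @hensel _ _ _ _ K_padic (fun y => y ^+ 3 - S * y ^+ 2 - P * y) 3 9 (c ^+ 2) 1.
- move=> x y hx hy xy.
  have x1 := abs_int_close (abs_nat_le1 3) hx; have y1 := abs_int_close (abs_nat_le1 3) hy.
  rewrite (_ : _ - _ = (x - y) * ((x - 3) * (x + 3) + (x - 3) * y + 3 * (y - 3) +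
    (y - 3) * (y + 3) - (theta - 1) * (theta + 2) * (x + y) - 3 * ((x - 3) + (y - 3)) - P));
    last by ring.
  rewrite (padic_absM K_padic) h9 mul1r.
  rewrite gtr_pMr ?(padic_abs_gt0 K_padic) ?subr_eq0 //.
  by small.
- by rewrite -(abs_eq0 K_padic) h9 oner_eq0.
- rewrite h9 mul1r (_ : _ - _ = c ^+ 2 + 9 * ((theta - 1) * (theta + 2)) + 3 * P); last by ring.
  by small.
exists y; last by rewrite e subrr.
by rewrite -abs3; apply: (abs_close K_padic); rewrite abs3.
Qed.

(** At y = c z the cubic is divisible by c^2, and the quotient reduces to -(3 z^2 + 3 z + 1). Its
    discriminant is -3, a unit, so its roots are simple and lift. *)
Lemma cubic_root_near (zeta : K) : abs zeta <= 1 ->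
  abs (3 * zeta ^+ 2 + 3 * zeta + 1) < 1 ->
  exists z, [/\ abs (z - zeta) < 1, abs z = 1 & cubic (c * z) = 0].
Proof.
move=> z1 hz.
have hd : abs (- (6 * zeta + 3)) = 1.
  rewrite (padic_absN K_padic); apply/eqP.
  rewrite -(@eqrXn2 _ 2) ?(abs_ge0 K_padic) // expr1n -(absX K_padic).
  rewrite (_ : _ ^+ 2 = - 3 + 12 * (3 * zeta ^+ 2 + 3 * zeta + 1)); last by ring.
  rewrite (absD_dom K_padic) (padic_absN K_padic) abs3 //.
  by small.
have [|||z hz' e] := @hensel _ _ _ _ K_padic
  (fun z => c * z ^+ 3 - S * z ^+ 2 - (2 * theta + 1) * z) zeta (- (6 * zeta + 3)) 1 1.
- move=> x y hx hy xy.
  have x1 := abs_int_close z1 hx; have y1 := abs_int_close z1 hy.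
  rewrite (_ : _ - _ = (x - y) * (c * (x ^+ 2 + x * y + y ^+ 2)
     - (theta - 1) * (theta + 2) * (x + y) - 3 * ((x - zeta) + (y - zeta))
     - 2 * (theta - 1))); last by ring.
  rewrite (padic_absM K_padic) hd mul1r.
  rewrite gtr_pMr ?(padic_abs_gt0 K_padic) ?subr_eq0 //.
  by small.
- by rewrite -(abs_eq0 K_padic) hd oner_eq0.
- rewrite hd mul1r (_ : _ - _ = (3 * zeta ^+ 2 + 3 * zeta + 1) +
    (theta - 1) * (theta + 2) * zeta ^+ 2 + 2 * (theta - 1) * zeta - c * zeta ^+ 3); last by ring.
  by small.
exists z; split=> //; last first.
  by rewrite (_ : cubic _ = c ^+ 2 *
    (c * z ^+ 3 - S * z ^+ 2 - (2 * theta + 1) * z - 1)); [rewrite e subrr mulr0|ring].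
apply/eqP; rewrite eq_le (abs_int_close z1 hz') /= leNgt; apply/negP => z_lt1.
have : abs (1 : K) < 1.
  rewrite (_ : 1 = (3 * zeta ^+ 2 + 3 * zeta + 1) - 3 * (zeta + 1) * ((zeta - z) + z)); last by ring.
  rewrite (absB_lt K_padic) //; apply: absM_lt1l; first by integral.
  by apply: (absD_lt K_padic) => //; rewrite (abs_distC K_padic).
by rewrite (abs1 K_padic) ltxx.
Qed.

Lemma cubic_roots : exists y1 y2 y3, [/\ abs y1 = 1, abs y2 = abs c, abs y3 = abs c &
  [/\ S = y1 + y2 + y3, P = - (y1 * y2 + y1 * y3 + y2 * y3) & c ^+ 2 = y1 * y2 * y3]].
Proof.
have [y1 ny1 r1] := cubic_root1.
have [n pn] := dvd_prime_omega hp hp3.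
have n30 : (3 : K) != 0 by rewrite -(abs_eq0 K_padic) abs3 oner_eq0.
(* If omega is a root of X^2 + X + 1, then -(omega + 2) / 3 is a root of 3 z^2 + 3 z + 1; here [n]
   is such a root modulo p. The conjugate root is -1 - zeta. *)
pose zeta : K := - (n%:R + 2) / 3.
have z1 : abs zeta <= 1.
  rewrite (abs_div K_padic) abs3 divr1; integral.
have hz : abs (3 * zeta ^+ 2 + 3 * zeta + 1) < 1.
  rewrite (_ : _ + 1 = (n ^ 2 + n + 1)%:R / 3); last first.
    by rewrite /zeta !natrD natrX; field.
  by rewrite (abs_div K_padic) abs3 divr1; apply: (padic_abs_nat_lt1 K_padic).
have [z2 [hz2 nz2 r2]] := cubic_root_near z1 hz.
have [||z3 [hz3 nz3 r3]] := @cubic_root_near (- 1 - zeta).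
- by integral.
- by rewrite (_ : _ + 1 = 3 * zeta ^+ 2 + 3 * zeta + 1) //; ring.
(* The two approximate roots differ by 2 zeta + 1, a unit, and the lifts stay in distinct residue
   classes. *)
have z23 : z2 - z3 != 0.
  have hd : abs (2 * zeta + 1) = 1.
    apply/eqP; rewrite -(@eqrXn2 _ 2) ?(abs_ge0 K_padic) // expr1n -(absX K_padic).
    rewrite -[X in X == _]mul1r -{1}abs3 -(padic_absM K_padic).
    rewrite (_ : _ * _ = - 1 + 4 * (3 * zeta ^+ 2 + 3 * zeta + 1)); last by ring.
    rewrite (absD_dom K_padic) (padic_absN K_padic) (abs1 K_padic) //.
    by small.
  rewrite -(abs_eq0 K_padic) (_ : z2 - z3 =
    (2 * zeta + 1) + ((z2 - zeta) - (z3 - (- 1 - zeta)))); last by ring.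
  rewrite (absD_dom K_padic) hd ?oner_eq0 //; small.
exists y1, (c * z2), (c * z3); split=> //.
- by rewrite (padic_absM K_padic) nz2 mulr1.
- by rewrite (padic_absM K_padic) nz3 mulr1.
have y12 : y1 - c * z2 != 0.
  by rewrite -(abs_eq0 K_padic) (absB_dom K_padic) ny1 ?oner_eq0 //; small.
have y13 : y1 - c * z3 != 0.
  by rewrite -(abs_eq0 K_padic) (absB_dom K_padic) ny1 ?oner_eq0 //; small.
have y23 : c * z2 - c * z3 != 0 by rewrite -mulrBr mulf_neq0.
move: (c * z2) (c * z3) r2 r3 y12 y13 y23 => y2 y3 r2 r3 y12 y13 y23.
(* Vieta's formulas by divided differences: the difference of the cubic at two distinct roots is
   divided by the gap, then the same is done with the two resulting equations. *)
have e12 : y1 ^+ 2 + y1 * y2 + y2 ^+ 2 - S * (y1 + y2) - P = 0.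
  apply: (mulfI y12); rewrite mulr0 [LHS](_ : _ = cubic y1 - cubic y2); last by ring.
  by rewrite r1 r2 subrr.
have e13 : y1 ^+ 2 + y1 * y3 + y3 ^+ 2 - S * (y1 + y3) - P = 0.
  apply: (mulfI y13); rewrite mulr0 [LHS](_ : _ = cubic y1 - cubic y3); last by ring.
  by rewrite r1 r3 subrr.
have eS : S = y1 + y2 + y3.
  apply/eqP; rewrite eq_sym -subr_eq0; apply/eqP; apply: (mulfI y23); rewrite mulr0.
  rewrite [LHS](_ : _ = (y1 ^+ 2 + y1 * y2 + y2 ^+ 2 - S * (y1 + y2) - P) -
    (y1 ^+ 2 + y1 * y3 + y3 ^+ 2 - S * (y1 + y3) - P)); last by ring.
  by rewrite e12 e13 subrr.
have eP : P = - (y1 * y2 + y1 * y3 + y2 * y3).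
  rewrite (_ : P = y1 ^+ 2 + y1 * y2 + y2 ^+ 2 - S * (y1 + y2)); first by rewrite eS; ring.
  by apply/eqP; rewrite eq_sym -subr_eq0 e12.
split=> //; rewrite (_ : c ^+ 2 = y1 ^+ 3 - S * y1 ^+ 2 - P * y1); first by rewrite eS eP; ring.
by apply/eqP; rewrite eq_sym -subr_eq0 r1.
Qed.

(** The values at 0, 1 and -1 determine the coefficients, as 2 is a unit. *)
Lemma cubic_coefs y1 y2 y3 :
  (forall y, cubic y = (y - y1) * (y - y2) * (y - y3)) ->
  [/\ S = y1 + y2 + y3, P = - (y1 * y2 + y1 * y3 + y2 * y3) & c ^+ 2 = y1 * y2 * y3].
Proof.
have n20 : (2 : K) != 0 by rewrite -(abs_eq0 K_padic) abs2 oner_eq0.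
move=> H; have e3 : c ^+ 2 = y1 * y2 * y3.
  by apply: oppr_inj; rewrite (_ : - (c ^+ 2) = cubic 0); [rewrite H|]; ring.
split=> //; apply: (mulfI n20); apply: oppr_inj.
- rewrite (_ : - (2 * S) = cubic 1 + cubic (- 1) + 2 * c ^+ 2); last by ring.
  by rewrite !H e3; ring.
- rewrite (_ : - (2 * P) = cubic 1 - cubic (- 1) - 2); last by ring.
  by rewrite !H; ring.
Qed.

(** The discriminant (y1 (y2 + y3))^2 - 4 y1^2 y2 y3 of the quadratic factor, scaled by y1^2, equals
    c^2 times a unit reducing to -3. *)
Lemma cubic_root_gap y1 y2 y3 :
  S = y1 + y2 + y3 -> P = - (y1 * y2 + y1 * y3 + y2 * y3) -> c ^+ 2 = y1 * y2 * y3 ->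
  abs y1 = 1 -> abs y2 = abs c -> abs y3 = abs c -> abs (y2 - y3) = abs c.
Proof.
move=> e1 e2 e3 n1 n2 n3.
have hy1 : abs (y1 - 3) < 1.
  have y2_lt1 : abs y2 < 1 by rewrite n2.
  have y3_lt1 : abs y3 < 1 by rewrite n3.
  rewrite (_ : y1 - 3 = (theta - 1) * (theta + 2) - y2 - y3); first by small.
  by rewrite (_ : y1 = S - y2 - y3); [ring|rewrite e1; ring].
(* The product y2 y3 has size |c|^2, so one factor c can be extracted and a small [t] remains. *)
pose t := y2 * y3 / c; have ht : abs t < 1.
  by rewrite /t (abs_div K_padic) (padic_absM K_padic) n2 n3 mulfK // (abs_eq0 K_padic).
have t_eq : y2 * y3 = c * t by rewrite /t [RHS]mulrC divfK.
have e : y1 ^+ 2 * (y2 - y3) ^+ 2 = c ^+ 2 * (- 3 + (4 * ((theta - 1) * (theta + 2))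
    - 4 * (y1 - 3) + 2 * (2 * theta + 1) * t + t ^+ 2)).
  have -> : y1 ^+ 2 * (y2 - y3) ^+ 2 =
      (- (y1 * y2 + y1 * y3 + y2 * y3) + y2 * y3) ^+ 2 - 4 * y1 * (y1 * y2 * y3) by ring.
  by rewrite -e2 -e3 t_eq; ring.
apply/eqP; rewrite -(@eqrXn2 _ 2) ?(abs_ge0 K_padic) //.
rewrite -[X in X == _]mul1r -[X in X * _ == _](expr1n _ 2) -n1 -!(absX K_padic) -(padic_absM K_padic) e.
rewrite (padic_absM K_padic) (absD_dom K_padic) (padic_absN K_padic) abs3 ?mulr1 //.
by small.
Qed.

End Roots.

End Cubes.

(** * Scaling and escape for the Potts-Bethe mapping *)

Section Dynamics.
Variables (R : realType) (p : nat) (K : fieldType) (abs : K -> R).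
Hypothesis K_padic : padic_abs p abs.
Hypothesis hp3 : (p = 1 %[mod 3])%N.
Variables (theta c : K) (f : K -> K).
Implicit Types (x y z w : K).

Local Notation T := (abs (theta - 1)).
Local Notation Q := (abs c).
Local Notation r := (Q * T).
Local Notation xi := (1 + c).
Local Notation g x := (theta + (theta - 1) * c / (x - xi)).

Hypotheses (T_gt0 : 0 < T) (TQ : T < Q) (Q_lt1 : Q < 1).
Hypothesis fE : forall x, x != xi -> f x = g x ^+ 3.

Let abs0 := padic_abs0 K_padic.
Let absM := padic_absM K_padic.
Let abs_gt0 := padic_abs_gt0 K_padic.

Let Q_gt0 : 0 < Q. Proof. exact: lt_trans TQ. Qed.
Let r_gt0 : 0 < r. Proof. by rewrite mulr_gt0. Qed.
Let T_lt1 : T < 1. Proof. exact: lt_trans Q_lt1. Qed.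
Let r_ltT : r < T. Proof. by rewrite gtr_pMl. Qed.

Lemma abs_theta : abs theta = 1.
Proof. by rewrite (abs_close K_padic (y := 1)) ?(abs1 K_padic). Qed.

Lemma neq_xi x s : 0 < s -> abs (x - xi) = s -> x != xi.
Proof. by move=> s0 e; rewrite -subr_eq0 -(abs_eq0 K_padic) e gt_eqF. Qed.

Lemma g_theta x s : 0 < s -> abs (x - xi) = s -> abs (g x - theta) = r / s.
Proof. by move=> s0 e; rewrite addrAC subrr add0r (abs_div K_padic) absM e mulrC [Q * _]mulrC mulrC. Qed.

Lemma g_dist x y s t : 0 < s -> 0 < t -> abs (x - xi) = s -> abs (y - xi) = t ->
  abs (g x - g y) = r * abs (x - y) / (s * t).
Proof.
move=> s0 t0 ex ey; have x0 := neq_xi s0 ex; have y0 := neq_xi t0 ey.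
rewrite (_ : g x - g y = - (c * (theta - 1) * (x - y) / ((x - xi) * (y - xi)))); last first.
  by field; rewrite !subr_eq0 x0 y0.
by rewrite (padic_absN K_padic) (abs_div K_padic) !absM ex ey.
Qed.

(** The bound below 1 puts [g y] in the residue class of the unit [g x], where cubing is an
    isometry. *)
Lemma f_scale x y s t : 0 < s -> 0 < t -> abs (x - xi) = s -> abs (y - xi) = t ->
  abs (g x) = 1 -> r * abs (x - y) / (s * t) < 1 ->
  abs (f x - f y) = r * abs (x - y) / (s * t).
Proof.
move=> s0 t0 ex ey gx; rewrite -(g_dist s0 t0 ex ey) => h.
rewrite !fE ?(neq_xi s0 ex) ?(neq_xi t0 ey) //; apply: (cube_dist K_padic hp3 gx).
  by rewrite subrr abs0.
by rewrite (abs_distC K_padic).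
Qed.

(** A cube root [w] of [z] near [g x] exists because r / s <= 1. Being closer to [g x] than theta
    is, it lies at distance r / s from theta, and inverting the Moebius map there returns to the
    sphere of radius [s] around the pole. *)
Lemma f_onto x z s : 0 < s -> r <= s -> abs (x - xi) = s -> abs (g x) = 1 ->
  abs (z - f x) < r / s -> exists2 y, abs (y - x) < s & f y = z.
Proof.
move=> s0 rs ex gx hz; have rs0 : 0 < r / s by rewrite divr_gt0.
have [||w hw ew] := cube_onto K_padic hp3 (b := z) (rho := r / s) gx.
- by rewrite ler_pdivrMr // mul1r.
- by rewrite -fE // (neq_xi s0 ex).
have gt := g_theta s0 ex.
have hwt : abs (w - theta) = r / s by rewrite -gt; apply: (abs_close_dist K_padic); rewrite gt.
have wt0 : w - theta != 0 by rewrite -(abs_eq0 K_padic) hwt gt_eqF.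
have e0 : (theta - 1) * c != 0 by rewrite mulf_neq0 // -(abs_eq0 K_padic) gt_eqF.
pose y := xi + (theta - 1) * c / (w - theta).
have ey : abs (y - xi) = s.
  rewrite /y addrAC subrr add0r (abs_div K_padic) absM hwt [T * Q]mulrC.
  by rewrite invfM invrK mulrA mulfV ?mul1r // gt_eqF.
have gy : g y = w.
  rewrite /y [X in theta + _ / X = _](_ : _ = (theta - 1) * c / (w - theta)); last by ring.
  by rewrite invfM invrK mulrA mulfV // mul1r addrC subrK.
exists y; last by rewrite fE ?gy ?(neq_xi s0 ey).
move: hw; rewrite -[in abs (w - _)]gy (g_dist s0 s0 ey ex).
by rewrite -mulrA ltr_pM2l // invfM mulrA -[X in _ < X]mul1r ltr_pM2r ?invr_gt0 // ltr_pdivrMr // mul1r.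
Qed.

(** * Scaling around a fixed point at distance s from the pole (s = |theta - 1| or s = r) *)

Section FixedPoint.
Variables (x0 : K) (s : R).
Hypotheses (s_gt0 : 0 < s) (rs : r <= s) (sQ : s < Q).
Hypotheses (x0s : abs (x0 - xi) = s) (fx0 : f x0 = x0).

Lemma fixed_near1 : abs (x0 - 1) = Q.
Proof.
rewrite (_ : x0 - 1 = c + (x0 - xi)); last by ring.
by rewrite (absD_dom K_padic) // x0s.
Qed.

(** The cube of [g x0] is [x0] itself, a unit because |x0 - 1| = |c| < 1. *)
Lemma g_fixed : abs (g x0) = 1.
Proof.
apply/eqP; rewrite -(@eqrXn2 _ 3) ?(abs_ge0 K_padic) // expr1n -(absX K_padic) -fE ?(neq_xi s_gt0 x0s) //.
by rewrite fx0 (abs_close K_padic (y := 1)) ?fixed_near1 (abs1 K_padic).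
Qed.

Lemma ball_fixed x : abs (x - x0) < s -> abs (x - xi) = s.
Proof. by rewrite -x0s; apply: (abs_close_dist K_padic). Qed.

Lemma g_ball_fixed x : abs (x - x0) < s -> abs (g x) = 1.
Proof.
move=> hx; rewrite -g_fixed; apply: (abs_close K_padic).
rewrite g_fixed (g_dist s_gt0 s_gt0 (ball_fixed hx) x0s).
rewrite ltr_pdivrMr ?mulr_gt0 // mul1r; apply: (lt_le_trans (y := r * s)); first by rewrite ltr_pM2l.
by rewrite ler_pM2r.
Qed.

Lemma f_scale_fixed x y : abs (x - x0) < s -> abs (y - x0) < s ->
  abs (f x - f y) = r / s ^+ 2 * abs (x - y).
Proof.
move=> hx hy; rewrite (f_scale s_gt0 s_gt0 (ball_fixed hx) (ball_fixed hy) (g_ball_fixed hx)).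
  by rewrite -expr2 mulrAC.
have hxy : abs (x - y) < s by apply: (abs_trans_lt K_padic hx); rewrite (abs_distC K_padic).
rewrite ltr_pdivrMr ?mulr_gt0 // mul1r; apply: (lt_le_trans (y := r * s)); first by rewrite ltr_pM2l.
by rewrite ler_pM2r.
Qed.

Lemma f_onto_fixed z : abs (z - x0) < r / s -> exists2 x, abs (x - x0) < s & f x = z.
Proof. by move=> hz; apply: (f_onto s_gt0 rs x0s g_fixed); rewrite fx0. Qed.

End FixedPoint.

(** The fixed point equation is the cubic times (theta - 1) y + c, a factor equal to x - 1 that
    accounts for the fixed point 1. *)
Lemma xfix_fixed y : y != 0 ->
  y ^+ 3 - (1 + theta + theta ^+ 2) * y ^+ 2 - (2 * theta + 1) * c * y - c ^+ 2 = 0 ->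
  f (xi + (theta - 1) * y) = xi + (theta - 1) * y.
Proof.
move=> y0 hy; have t0 : theta - 1 != 0 by rewrite -(abs_eq0 K_padic) gt_eqF.
rewrite fE; last by rewrite -subr_eq0 addrAC subrr add0r mulf_neq0.
rewrite (_ : g _ = (theta * y + c) / y); last first.
  by rewrite [X in _ / X](_ : _ = (theta - 1) * y); [field; rewrite y0 t0|ring].
rewrite exprMn exprVn; apply: (canLR (mulfK _)); first by rewrite expf_neq0.
apply/eqP; rewrite eq_sym -subr_eq0.
rewrite (_ : _ - _ = ((theta - 1) * y + c) *
  (y ^+ 3 - (1 + theta + theta ^+ 2) * y ^+ 2 - (2 * theta + 1) * c * y - c ^+ 2)); last by ring.
by rewrite hy mulr0.
Qed.

(** On this ball the distance to the pole is constantly Q, and the factor r / Q^2 is T / Q. *)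
Lemma near1_contract x : abs (x - 1) < Q -> abs (f x - 1) = T / Q * abs (x - 1).
Proof.
have n10 : abs (1 - xi) = Q.
  by rewrite (_ : 1 - xi = - c) ?(padic_absN K_padic) //; ring.
have c0 : c != 0 by rewrite -(abs_eq0 K_padic) gt_eqF.
have g1 : g 1 = 1 by rewrite [X in _ / X](_ : _ = - c); [field; rewrite ?oppr_eq0|ring].
move=> hx; have f1 : f 1 = 1 by rewrite fE ?(neq_xi Q_gt0 n10) // g1 expr1n.
have xQ : abs (x - xi) = Q by rewrite -n10; apply: (abs_close_dist K_padic); rewrite n10.
rewrite (abs_distC K_padic) -[in abs (1 - _)]f1 (f_scale Q_gt0 Q_gt0 n10 xQ).
- by rewrite (abs_distC K_padic); field; rewrite gt_eqF.
- by rewrite g1 (abs1 K_padic).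
- rewrite (abs_distC K_padic) ltr_pdivrMr ?mulr_gt0 // mul1r.
  apply: lt_trans (_ : Q * T * Q < _); first by rewrite ltr_pM2l.
  by rewrite -mulrA ltr_pM2l // gtr_pMl // (lt_trans T_lt1) // ltr01.
Qed.

(** Here |g x - theta| = r / |x - xi| < Q and |theta - 1| = T < Q, and cubing preserves the distance
    to 1. *)
Lemma far_near1 x : T < abs (x - xi) -> abs (f x - 1) < Q.
Proof.
move=> hx; have s0 : 0 < abs (x - xi) by exact: lt_trans hx.
have hg : abs (g x - 1) < Q.
  apply: (abs_trans_lt K_padic (y := theta)) => //.
  by rewrite (g_theta s0) // ltr_pdivrMr // ltr_pM2l.
by rewrite fE ?(neq_xi s0) // (cube_dist1 K_padic hp3) // (lt_trans hg).
Qed.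

(** * The Markov structure of the pieces and the escape of the other points *)

Section Attractor.
Variables x1 x2 x3 : K.
Hypotheses (fx1 : f x1 = x1) (fx2 : f x2 = x2) (fx3 : f x3 = x3).
Hypotheses (x1T : abs (x1 - xi) = T) (x2r : abs (x2 - xi) = r) (x3r : abs (x3 - xi) = r).
Hypothesis x23 : abs (x2 - x3) = r.

Local Notation lam := (T / Q).

Let lam_gt0 : 0 < lam. Proof. by rewrite divr_gt0. Qed.
Let lam_lt1 : lam < 1. Proof. by rewrite ltr_pdivrMr // mul1r. Qed.
Let r_ltQ : r < Q. Proof. exact: lt_trans TQ. Qed.

Lemma x1_scale x y : abs (x - x1) < T -> abs (y - x1) < T ->
  abs (f x - f y) = lam^-1 * abs (x - y).
Proof.
move=> hx hy; rewrite (f_scale_fixed T_gt0 (ltW r_ltT) TQ x1T fx1) //.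
by congr (_ * _); field; rewrite !gt_eqF.
Qed.

Lemma x1_onto z : abs (z - x1) < Q -> exists2 x, abs (x - x1) < T & f x = z.
Proof.
move=> hz; apply: (f_onto_fixed T_gt0 (ltW r_ltT) TQ x1T fx1).
by rewrite mulfK // gt_eqF.
Qed.

Lemma x23_scale x0 x y : f x0 = x0 -> abs (x0 - xi) = r ->
  abs (x - x0) < r -> abs (y - x0) < r -> abs (f x - f y) = r^-1 * abs (x - y).
Proof.
move=> fx0 x0r hx hy; rewrite (f_scale_fixed r_gt0 (lexx _) r_ltQ x0r fx0) //.
by congr (_ * _); field; rewrite !gt_eqF.
Qed.

Lemma x23_onto x0 z : f x0 = x0 -> abs (x0 - xi) = r ->
  abs (z - x0) < 1 -> exists2 x, abs (x - x0) < r & f x = z.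
Proof.
move=> fx0 x0r hz; apply: (f_onto_fixed r_gt0 (lexx _) r_ltQ x0r fx0).
by rewrite mulfV // gt_eqF.
Qed.

Lemma x21_dist : abs (x2 - x1) = T.
Proof.
rewrite (_ : x2 - x1 = (x2 - xi) - (x1 - xi)); last by ring.
by rewrite (absB_doml K_padic) x1T // x2r.
Qed.

Lemma x31_dist : abs (x3 - x1) = T.
Proof.
rewrite (_ : x3 - x1 = (x3 - xi) - (x1 - xi)); last by ring.
by rewrite (absB_doml K_padic) x1T // x3r.
Qed.

(** The inverse branch at x^(1) is defined on the ball of radius Q and has values in the smaller
    ball of radius T, so it can be iterated from x^(2). *)
Lemma backward_orbit : exists a : nat -> K, a 0%N = x2 /\
  forall l, abs (a l.+1 - x1) < T /\ f (a l.+1) = a l.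
Proof.
have /choice[inv hinv] : forall z, exists x, abs (z - x1) < Q -> abs (x - x1) < T /\ f x = z.
  move=> z; have [hz|hz] := boolP (abs (z - x1) < Q).
    by have [x hx ex] := x1_onto hz; exists x.
  by exists z.
pose a n := iter n inv x2; have aQ n : abs (a n - x1) < Q.
  elim: n => [|n IH]; first by rewrite /= x21_dist.
  by apply: lt_trans (hinv _ IH).1 _.
by exists a; split=> // l; apply: hinv; exact: aQ.
Qed.

(* [a l] is the center of the ball H_l, with H_0 = C_2; moreover [a m.+1] lies in
   D_1. In this way all the pieces but C_3 are the balls around [a 0 .. a m.+1]. *)
Variables (a : nat -> K) (m : nat).
Hypotheses (a0 : a 0%N = x2) (aT : forall l, abs (a l.+1 - x1) < T)
  (fa : forall l, f (a l.+1) = a l).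
Hypotheses (m_gt0 : (0 < m)%N) (Qlam : Q <= lam ^+ m) (lamQ : lam ^+ m.+1 < Q).

Let lamX_gt0 l : 0 < lam ^+ l. Proof. exact: exprn_gt0. Qed.
Let lam_anti k l : (k <= l)%N -> lam ^+ l <= lam ^+ k.
Proof. by move=> kl; rewrite ler_wiXn2l // ltW. Qed.
Let lam_santi k l : (k < l)%N -> lam ^+ l < lam ^+ k.
Proof. by move=> kl; rewrite ltr_iXn2l. Qed.

Lemma a_x1_dist l : abs (a l - x1) = T * lam ^+ l.
Proof.
elim: l => [|l IH]; first by rewrite a0 x21_dist mulr1.
have := x1_scale (aT l) (_ : abs (x1 - x1) < T); rewrite fa fx1 IH subrr abs0.
by move=> /(_ T_gt0) e; rewrite exprSr mulrA e mulrAC mulVf ?mul1r // gt_eqF.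
Qed.

Lemma a_dist k l : (k < l)%N -> abs (a k - a l) = T * lam ^+ k.
Proof.
move=> kl; rewrite (_ : a k - a l = (a k - x1) - (a l - x1)); last by ring.
by rewrite (absB_dom K_padic) !a_x1_dist // ltr_pM2l // lam_santi.
Qed.

Lemma a_x3_dist l : abs (a l.+1 - x3) = T.
Proof.
rewrite (_ : _ - _ = (a l.+1 - x1) - (x3 - x1)); last by ring.
by rewrite (absB_doml K_padic) x31_dist.
Qed.

(** With [Tlam_lt_r], this is the role of m: the distance T lam^k from [a k] to x^(1) is at least r
    exactly for k <= m. *)
Lemma r_le_lam k : (k <= m)%N -> r <= T * lam ^+ k.
Proof. by move=> km; rewrite mulrC ler_pM2l // (le_trans Qlam) // lam_anti. Qed.

Lemma Tlam_lt_r k : (m < k)%N -> T * lam ^+ k < r.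
Proof. by move=> km; rewrite [Q * T]mulrC ltr_pM2l // (le_lt_trans _ lamQ) // lam_anti. Qed.

Lemma rE : lam^-1 * r = Q ^+ 2.
Proof. by field; rewrite !gt_eqF. Qed.

(** Q^2 = r / lam is the radius of the image of a piece near x^(1), and T lam^k is the distance from
    [a k] to any later [a l]; this comparison decides the transitions. *)
Lemma Tlam_Q2 k : (T * lam ^+ k < Q ^+ 2) = (m <= k)%N.
Proof.
rewrite -rE -[X in X < _](mulKf (x := lam)) ?gt_eqF // ltr_pM2l ?invr_gt0 //.
rewrite mulrCA -exprS [Q * T]mulrC ltr_pM2l //.
have [km|km] := leqP m k; first by rewrite (le_lt_trans _ lamQ) // lam_anti.
by apply/negbTE; rewrite -leNgt (le_trans Qlam) // lam_anti.
Qed.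

Lemma near_x1_neq_xi x : abs (x - x1) < T -> x != xi.
Proof. by move=> hx; apply/eqP => e; rewrite e (abs_distC K_padic) x1T ltxx in hx. Qed.

Lemma a_x1_le l : abs (a l - x1) <= T.
Proof.
by rewrite a_x1_dist ler_piMr ?exprn_ile1 ?(ltW lam_gt0) ?(ltW lam_lt1) ?(ltW T_gt0).
Qed.

Lemma a_sphere l x : (l <= m)%N -> abs (x - a l) < r -> abs (x - x1) = T * lam ^+ l.
Proof.
move=> lm hx; rewrite -a_x1_dist; apply: (abs_close_dist K_padic).
by rewrite a_x1_dist (lt_le_trans hx) // r_le_lam.
Qed.

(** The closed ball is taken because it contains C_3, whose center is at distance exactly r from
    x^(2). The factor lam^l restores a strict inequality for l > 0, and the last clause keeps the
    orbit off the pole. *)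
Lemma a_pullback l z : abs (z - x2) <= r -> exists x,
  [/\ abs (x - a l) <= lam ^+ l * r, iter l f x = z &
      forall k, (k < l)%N -> abs (iter k f x - x1) < T].
Proof.
move=> hz; elim: l => [|l [y [hy ey ky]]]; first by exists z; rewrite mul1r a0.
have yr : abs (y - a l) <= r.
  by apply: le_trans hy _; rewrite ler_piMl ?(ltW r_gt0) // exprn_ile1 ?(ltW lam_gt0) ?(ltW lam_lt1).
have [|x hx ex] := @x1_onto y.
  apply: (abs_trans_lt K_padic (y := a l)); first exact: le_lt_trans r_ltQ.
  exact: le_lt_trans (a_x1_le l) TQ.
exists x; split; last 2 first.
- by rewrite iterSr ex.
- by case=> [//|k kl]; rewrite iterSr ex; exact: ky.
have := x1_scale hx (aT l); rewrite ex fa => e.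
rewrite exprS -mulrA -ler_pdivrMl //; by rewrite -e.
Qed.

(** [f] is injective near x^(1) and maps each sphere of radius T lam^(l+1) into the one of radius T
    lam^l. This pins down the ball chosen in [piece_H]. *)
Lemma a_unique l x : abs (x - x1) = T * lam ^+ l -> iter l f x = x2 -> x = a l.
Proof.
elim: l x => [|l IH] x hx; first by rewrite a0.
rewrite iterSr => ex; have xT : abs (x - x1) < T.
  by rewrite hx gtr_pMr // exprn_ilt1 // ltW.
have := x1_scale xT (_ : abs (x1 - x1) < T); rewrite fx1 subrr abs0 => /(_ T_gt0) e.
have fx : f x = a l by apply: IH => //; rewrite e hx exprS mulrCA mulKf // gt_eqF.
have := x1_scale xT (aT l); rewrite fx fa subrr abs0 => /esym/eqP.
rewrite mulf_eq0 invr_eq0 (gt_eqF lam_gt0) /= (abs_eq0 K_padic) subr_eq0.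
by move/eqP.
Qed.

(** The index runs backwards along the orbit: 0 gives [a m.+1], a center of D_1 used in place of
    x^(1), and m + 1 gives [a 0] = x^(2). *)
Definition ctr (i : nat) : K := if (i <= m.+1)%N then a (m.+1 - i) else x3.

Definition scale (i : nat) : R := if (i <= m)%N then lam^-1 else r^-1.

Lemma ctr_last i : (m.+1 < i)%N -> ctr i = x3.
Proof. by move=> mi; rewrite /ctr leqNgt mi. Qed.

Lemma ctr_sep i j : (i <= m.+2)%N -> (j <= m.+2)%N -> i != j -> r <= abs (ctr i - ctr j).
Proof.
wlog ij : i j / (i < j)%N => [H hi hj ne|hi hj _].
  have [ij|ji|e] := ltngtP i j; first exact: H.
    by rewrite (abs_distC K_padic); apply: H => //; rewrite eq_sym.
  by rewrite e eqxx in ne.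
rewrite /ctr; have -> : (i <= m.+1)%N by clear -ij hj; lia.
case: ifP => hj'.
  by rewrite (abs_distC K_padic) a_dist ?r_le_lam //; clear -ij hj'; lia.
have [->|i0] := posnP (m.+1 - i); first by rewrite a0 x23.
by rewrite -(prednK i0) a_x3_dist ltW.
Qed.

Lemma ctr_lt_x1 i : (i <= m)%N -> exists2 l, ctr i = a l.+1 & (l = m - i)%N.
Proof. by move=> im; exists (m - i)%N; rewrite // /ctr leqW // subSn. Qed.

Lemma ctr_fixed i : (m < i)%N -> f (ctr i) = ctr i /\ abs (ctr i - xi) = r.
Proof.
rewrite /ctr; case: ifP => // hi mi; have -> : (m.+1 - i = 0)%N by clear -hi mi; lia.
by rewrite a0.
Qed.

Lemma scale_gt1 i : 1 < scale i.
Proof.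
rewrite /scale; case: ifP => _; rewrite invf_gt1 //.
by rewrite (lt_trans r_ltT).
Qed.

Lemma ctr_scale i x y : abs (x - ctr i) < r -> abs (y - ctr i) < r ->
  abs (f x - f y) = scale i * abs (x - y).
Proof.
rewrite /scale; case: ifP => [im|/negbT]; last first.
  by rewrite -ltnNge => /ctr_fixed[fi ri]; exact: x23_scale.
have [l -> _] := ctr_lt_x1 im => hx hy.
by apply: x1_scale; apply: (abs_trans_lt K_padic) (aT l); apply: lt_trans r_ltT.
Qed.

Lemma ctr_onto i z : abs (z - f (ctr i)) < scale i * r ->
  exists2 x, abs (x - ctr i) < r & f x = z.
Proof.
rewrite /scale; case: ifP => [im|/negbT]; last first.
  by rewrite -ltnNge mulVf ?gt_eqF // => /ctr_fixed[fi ri]; rewrite {1}fi; exact: x23_onto.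
have [l -> _] := ctr_lt_x1 im; rewrite fa rE => hz.
have Q2 : Q ^+ 2 < Q by rewrite expr2 gtr_pMl.
have [|x hx ex] := @x1_onto z.
  apply: (abs_trans_lt K_padic (y := a l)); first exact: lt_trans Q2.
  exact: le_lt_trans (a_x1_le l) TQ.
exists x => //; move: hz; rewrite -ex -fa x1_scale // -rE ltr_pM2l //.
by rewrite invr_gt0.
Qed.

Definition adj (i j : nat) : bool :=
  if (i < m)%N then ((i == 0%N) && (j == 0%N)) || (j == i.+1)
  else if i == m then (m < j)%N else true.

(** For i <= m the image is the ball of radius Q^2 around [a (m - i)]. It contains another [a k]
    only if both indices are at least m, that is i = j = 0, and x^(3) only if its center is x^(2).
    For i > m the image has radius 1. *)
Lemma ctr_adj i j : (i <= m.+2)%N -> (j <= m.+2)%N ->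
  (abs (ctr j - f (ctr i)) < scale i * r) = adj i j.
Proof.
move=> hi hj; rewrite /adj /scale.
have [mi|im] := ltnP m i; last first.
  have [l ci el] := ctr_lt_x1 im; rewrite ci fa rE.
  have lT k : abs (x3 - a k.+1) < Q ^+ 2 = false.
    rewrite (abs_distC K_padic) a_x3_dist; have := Tlam_Q2 0; rewrite expr0 mulr1 => ->.
    by case: (m) m_gt0.
  have rQ2 : r < Q ^+ 2 by rewrite expr2 ltr_pM2l.
  rewrite /ctr; case: (leqP j m.+1) => jm.
    have [jl|lj|e] := ltngtP (m.+1 - j) l.
    - by rewrite a_dist // Tlam_Q2; clear -hi hj im el jm jl m_gt0; case: (ltngtP i m) => ?; lia.
    - by rewrite (abs_distC K_padic) a_dist // Tlam_Q2; clear -hi hj im el jm lj m_gt0; case: (ltngtP i m) => ?; lia.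
    - by rewrite e subrr abs0 exprn_gt0 //; clear -hi hj im el jm e m_gt0; case: (ltngtP i m) => ?; lia.
  have [lz|l0] := posnP l.
    by rewrite lz a0 (abs_distC K_padic) x23 rQ2; clear -hi hj im el jm lz m_gt0; case: (ltngtP i m) => ?; lia.
  by rewrite -(prednK l0) lT; clear -hi hj im el jm l0 m_gt0; case: (ltngtP i m) => ?; lia.
have -> : (i < m)%N = false by clear -mi; lia.
have -> : (i == m) = false by clear -mi; lia.
have [-> ri] := ctr_fixed mi; rewrite mulVf ?gt_eqF //.
have hT k : abs (ctr k - x1) <= T.
  by rewrite /ctr; case: ifP => _; rewrite ?x31_dist ?a_x1_le.
apply: le_lt_trans T_lt1; apply: (abs_trans_le K_padic (hT j)).
by rewrite (abs_distC K_padic).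
Qed.

Definition attracting_pieces x := exists2 i, (i <= m.+2)%N & abs (x - ctr i) < r.

Local Notation X := attracting_pieces.

Lemma piecesP x : X x <-> abs (x - x3) < r \/ exists2 l, (l <= m.+1)%N & abs (x - a l) < r.
Proof.
split=> [[i im]|[hx|[l lm hx]]].
- rewrite /ctr; case: ifP => h hx; last by left.
  by right; exists (m.+1 - i)%N => //; clear; lia.
- by exists m.+2; rewrite ?ctr_last.
- by exists (m.+1 - l)%N; [clear; lia|rewrite /ctr leq_subr subKn].
Qed.

Lemma pieces_x1 x : abs (x - x1) < r -> X x.
Proof.
move=> hx; apply/piecesP; right; exists m.+1 => //.
apply: (abs_trans_lt K_padic hx); rewrite (abs_distC K_padic) a_x1_dist.
exact: Tlam_lt_r.
Qed.

Lemma pieces_neq_xi x : X x -> x != xi.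
Proof.
move=> /piecesP[hx|[l lm hx]]; apply/eqP => e; rewrite e in hx.
  by rewrite (abs_distC K_padic) x3r ltxx in hx.
case: l lm hx => [|l] _ hx.
  by rewrite (abs_distC K_padic) a0 x2r ltxx in hx.
have /near_x1_neq_xi : abs (xi - x1) < T.
  by apply: (abs_trans_lt K_padic) (aT l); apply: lt_trans r_ltT.
by rewrite eqxx.
Qed.

(** Used in the contrapositive: near x^(1), a point outside the pieces is mapped outside them.
    Pulling back contracts by lam, so the closed ball of radius r around [a l] goes into the open
    one around [a l.+1]. *)
Lemma pieces_preimage x : abs (x - x1) < T -> X (f x) -> X x.
Proof.
have rlam : lam * r < r by rewrite gtr_pMl.
have back l : abs (x - x1) < T -> abs (f x - a l) <= r -> abs (x - a l.+1) < r.
  move=> hx; rewrite -fa x1_scale // => h; apply: le_lt_trans rlam.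
  by rewrite -ler_pdivrMl.
move=> hx /piecesP[h|[l lm h]]; apply/piecesP; right.
  exists 1%N => //; apply: back => //.
  by apply: (abs_trans_le K_padic (ltW h)); rewrite a0 (abs_distC K_padic) x23.
have [lm'|lm'] := ltnP l m.+1; first by exists l.+1 => //; apply: back; rewrite // ltW.
(* For l = m + 1 the preimage is near [a m.+2], which lies in D_1 together with [a m.+1]. *)
exists m.+1 => //; apply: (abs_trans_lt K_padic (back _ hx (ltW h))).
by rewrite (abs_distC K_padic) a_dist ?Tlam_lt_r //; clear -lm'; lia.
Qed.

(** The scaling formula still holds at distance T from x^(1) and gives |f x - x^(1)| = r / T = Q >
    T. *)
Lemma leave_fix1 x : abs (x - xi) = T -> abs (x - x1) = T -> T < abs (f x - xi).
Proof.
move=> hx hx1; have gx : abs (g x) = 1.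
  rewrite -abs_theta; apply: (abs_close K_padic).
  by rewrite (g_theta T_gt0) // mulfK ?gt_eqF // abs_theta.
have e : abs (f x - x1) = Q.
  have e1 : r * abs (x - x1) / (T * T) = Q by rewrite hx1; field; rewrite gt_eqF.
  by rewrite -[x1 in LHS]fx1 (f_scale T_gt0 T_gt0 hx x1T gx) e1.
rewrite (_ : _ - xi = (f x - x1) + (x1 - xi)); last by ring.
by rewrite (absD_dom K_padic (x := f x - x1)) e // x1T.
Qed.

(** The distance r / |x - xi| of [g x] from theta lies strictly between Q and 1. It dominates theta
    - 1, survives cubing, and dominates c. *)
Lemma leave_between x : r < abs (x - xi) -> abs (x - xi) < T -> T < abs (f x - xi).
Proof.
move=> h1 h2; have s0 : 0 < abs (x - xi) by exact: lt_trans h1.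
have gt := g_theta s0 erefl.
have s1 : r / abs (x - xi) < 1 by rewrite ltr_pdivrMr // mul1r.
have s2 : Q < r / abs (x - xi) by rewrite ltr_pdivlMr // ltr_pM2l.
have g1 : abs (g x - 1) = r / abs (x - xi).
  rewrite (_ : g x - 1 = (g x - theta) + (theta - 1)); last by ring.
  by rewrite (absD_dom K_padic) gt // (lt_trans TQ).
have f1 : abs (f x - 1) = r / abs (x - xi).
  by rewrite fE ?(neq_xi s0) // (cube_dist1 K_padic hp3) g1.
rewrite (_ : f x - xi = (f x - 1) - c); last by ring.
by rewrite (absB_dom K_padic (x := f x - 1)) f1 // (lt_trans TQ).
Qed.

Lemma leave_inside x : 0 < abs (x - xi) -> abs (x - xi) < r -> T < abs (f x - xi).
Proof.
move=> s0 h; have gt := g_theta s0 erefl.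
have s1 : 1 < r / abs (x - xi) by rewrite ltr_pdivlMr // mul1r.
have g1 : abs (g x) = r / abs (x - xi).
  rewrite -gt; apply/esym; rewrite (absB_dom K_padic) // abs_theta.
  by rewrite -(subrK theta (g x)) (absD_dom K_padic) gt ?abs_theta.
have f1 : 1 < abs (f x) by rewrite fE ?(neq_xi s0) // (absX K_padic) g1 exprn_egt1.
rewrite (absB_dom K_padic (x := f x)) ?(lt_trans T_lt1) //.
by rewrite (absD_dom K_padic) (abs1 K_padic).
Qed.

(** In the residue field, [g x2] and [g x3] are the two primitive cube roots of unity. Off C_2 and
    C_3, [g x] differs from both, and also from 1, so (g x)^3 - 1 is a unit. *)
Lemma leave_sphere x : abs (x - xi) = r -> r <= abs (x - x2) -> r <= abs (x - x3) ->
  T < abs (f x - xi).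
Proof.
move=> hx h2 h3; have gt := g_theta r_gt0 hx; rewrite mulfV ?gt_eqF // in gt.
have g_le1 : abs (g x) <= 1.
  by rewrite -(subrK theta (g x)) (absD_le K_padic) ?gt ?abs_theta.
have dist0 x0 : abs (x0 - xi) = r -> r <= abs (x - x0) -> abs (x - x0) = r.
  move=> h0 h; apply/eqP; rewrite eq_le h andbT.
  by apply: (abs_trans_le K_padic (y := xi)); rewrite ?hx // (abs_distC K_padic) h0.
have gdist x0 : abs (x0 - xi) = r -> r <= abs (x - x0) -> abs (g x - g x0) = 1.
  move=> h0 h; rewrite (g_dist r_gt0 r_gt0 hx h0) (dist0 _ h0 h).
  by rewrite mulfV // mulf_neq0 // gt_eqF.
have g2 := gdist _ x2r h2; have g3 := gdist _ x3r h3.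
have g23 : abs (g x2 - g x3) = 1.
  by rewrite (g_dist r_gt0 r_gt0 x2r x3r) x23 mulfV // mulf_neq0 // gt_eqF.
have gx1 : abs (g x - 1) = 1.
  by rewrite -(subrK theta (g x)) -addrA (absD_dom K_padic) gt.
have root x0 : f x0 = x0 -> abs (x0 - xi) = r ->
    abs (g x0) = 1 /\ abs (g x0 ^+ 2 + g x0 + 1) < 1.
  move=> f0 h0; have gt0 := g_theta r_gt0 h0; rewrite mulfV ?gt_eqF // in gt0.
  split; first exact: (g_fixed r_gt0 r_ltQ h0 f0).
  have n1 : abs (g x0 - 1) = 1.
    by rewrite -(subrK theta (g x0)) -addrA (absD_dom K_padic) gt0.
  have : abs (g x0 ^+ 3 - 1) < 1.
    by rewrite -fE ?(neq_xi r_gt0 h0) // f0 (fixed_near1 r_ltQ).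
  rewrite (_ : _ - 1 = (g x0 - 1) * (g x0 ^+ 2 + g x0 + 1)); last by ring.
  by rewrite absM n1 mul1r.
have [n2 r2] := root _ fx2 x2r; have [n3 r3] := root _ fx3 x3r.
move: (g x) (g x2) (g x3) (fE (neq_xi r_gt0 hx)) g_le1 gx1 g2 g3 g23 n2 r2 n3 r3.
move=> w w2 w3 fw w_le1 hw1 hw2 hw3 hw23 n2 r2 n3 r3.
(* Subtracting the two quadratic relations and cancelling the unit w2 - w3 gives Vieta's sum formula
   modulo the maximal ideal; hence w^2 + w + 1 reduces to (w - w2) (w - w3). *)
have sum : abs (w2 + w3 + 1) < 1.
  rewrite -[X in X < _]mul1r -[X in X * _]hw23 -absM.
  rewrite (_ : _ * _ = (w2 ^+ 2 + w2 + 1) - (w3 ^+ 2 + w3 + 1)); last by ring.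
  exact: (absB_lt K_padic).
have hw : abs (w ^+ 2 + w + 1) = 1.
  rewrite (_ : _ + 1 = (w - w2) * (w - w3) +
    ((w2 + w3 + 1) * w + (w2 ^+ 2 + w2 + 1) - w2 * (w2 + w3 + 1))); last by ring.
  have n : abs ((w - w2) * (w - w3)) = 1 by rewrite absM hw2 hw3 mulr1.
  rewrite (absD_dom K_padic) n //; apply: (absB_lt K_padic).
    apply: (absD_lt K_padic) => //; exact: (absM_lt1r K_padic).
  by rewrite absM n2 mul1r.
have f1 : abs (f x - 1) = 1.
  rewrite fw (_ : _ - 1 = (w - 1) * (w ^+ 2 + w + 1)); last by ring.
  by rewrite absM hw1 hw mulr1.
rewrite (_ : f x - xi = (f x - 1) - c); last by ring.
by rewrite (absB_dom K_padic (x := f x - 1)) f1.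
Qed.

Lemma leave_far x : x != xi -> ~ X x -> T <= abs (x - x1) ->
  T < abs (x - xi) \/ T < abs (f x - xi).
Proof.
move=> x0 nX h1; have s0 : 0 < abs (x - xi) by rewrite abs_gt0 // subr_eq0.
have [hT|hT|hT] := ltgtP (abs (x - xi)) T; [right|by left|right].
  have [hr|hr|hr] := ltgtP (abs (x - xi)) r.
  - exact: leave_inside.
  - exact: leave_between.
  apply: leave_sphere => //; rewrite leNgt; apply/negP => h; apply: nX; apply/piecesP.
    by right; exists 0%N; rewrite // a0.
  by left.
apply: leave_fix1 => //; apply/eqP; rewrite eq_le h1 andbT.
by apply: (abs_trans_le K_padic (y := xi)); rewrite ?hT // (abs_distC K_padic) x1T.
Qed.

(** As long as the orbit is within T of x^(1), its distance to x^(1) grows by the factor 1 / lam.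
    This distance is at least r initially, so m + 1 steps suffice to reach T, since T lam^(m+1) <
    r. *)
Lemma escape x : (forall n, iter n f x != xi) -> ~ X x ->
  exists n, T < abs (iter n f x - xi).
Proof.
have key n y : (forall n, iter n f y != xi) -> ~ X y -> T <= lam^-1 ^+ n * abs (y - x1) ->
    exists n, T < abs (iter n f y - xi).
  elim: n y => [|n IH] y yxi nX; last first.
    rewrite exprSr -mulrA; have [hy|hy _] := ltP (abs (y - x1)) T; last first.
      by case: (leave_far (yxi 0%N) nX hy); [exists 0%N|exists 1%N].
    have -> : lam^-1 * abs (y - x1) = abs (f y - x1).
      by rewrite -[x1 in RHS]fx1 x1_scale // subrr abs0.
    move=> hfy; have [k|Xf|k hk] := IH (f y) _ _ hfy.
    - by rewrite -iterSr.
    - exact/nX/(pieces_preimage hy).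
    - by exists k.+1; rewrite iterSr.
  rewrite expr0 mul1r => h; case: (leave_far (yxi 0%N) nX h); [by exists 0%N|by exists 1%N].
move=> xxi nX; have hr : r <= abs (x - x1).
  by rewrite leNgt; apply/negP => /pieces_x1.
apply: (key m.+1) => //; apply: le_trans (_ : lam^-1 ^+ m.+1 * r <= _); last first.
  by rewrite ler_pM2l // exprn_gt0 // invr_gt0.
by rewrite exprVn mulrC ler_pdivlMr // ltW // Tlam_lt_r.
Qed.

Lemma escape_near1 x : (forall n, iter n f x != xi) -> ~ X x ->
  exists n, abs (iter n f x - 1) < Q.
Proof. by move=> h nX; have [n hn] := escape h nX; exists n.+1; exact: far_near1. Qed.

Lemma near1_iter x n : abs (x - 1) < Q -> abs (iter n f x - 1) = lam ^+ n * abs (x - 1).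
Proof.
move=> hx; elim: n => [|n IH]; first by rewrite mul1r.
rewrite iterS near1_contract IH ?exprS ?mulrA //.
by apply: le_lt_trans hx; rewrite ler_piMl ?(abs_ge0 K_padic) // exprn_ile1 // ltW.
Qed.

End Attractor.
End Dynamics.

(** * Coding of expanding Markov maps *)

Section Coding.
Variables (R : realType) (p : nat) (K : fieldType) (abs : K -> R).
Hypothesis K_padic : padic_abs p abs.
Variables (I : choiceType) (ctr : I -> K) (sigma : I -> R) (r : R) (f : K -> K)
  (adj : I -> I -> bool).
Hypotheses (r_gt0 : 0 < r) (sigma_ge : forall i, p%:R <= sigma i).
Hypothesis ctr_scale : forall i x y, abs (x - ctr i) < r -> abs (y - ctr i) < r ->
  abs (f x - f y) = sigma i * abs (x - y).
Hypothesis ctr_onto : forall i z, abs (z - f (ctr i)) < sigma i * r ->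
  exists2 x, abs (x - ctr i) < r & f x = z.
Hypothesis ctr_sep : forall i j, i != j -> r <= abs (ctr i - ctr j).
Hypothesis ctr_adj : forall i j, (abs (ctr j - f (ctr i)) < sigma i * r) = adj i j.
Implicit Types (x y : K) (s t : nat -> I).

Let sigma_gt1 i : 1 < sigma i.
Proof. exact: lt_le_trans (primeR_gt1 K_padic) (sigma_ge i). Qed.
Let sigma_gt0 i : 0 < sigma i. Proof. exact: lt_trans (sigma_gt1 i). Qed.

Definition follows s n x := abs (iter n f x - ctr (s n)) < r.
Definition admissible s := forall n, adj (s n) (s n.+1).
Definition survivors x := forall n, exists i, abs (iter n f x - ctr i) < r.

Lemma followsS s n x : follows s n.+1 x = follows (fun k => s k.+1) n (f x).
Proof. by rewrite /follows iterSr. Qed.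

Lemma ball_sep i j x : abs (x - ctr i) < r -> abs (x - ctr j) < r -> i = j.
Proof.
move=> hi hj; apply/eqP; apply: contraT => /ctr_sep; rewrite leNgt => /negP[].
by apply: (abs_trans_lt K_padic (y := x)); rewrite // (abs_distC K_padic).
Qed.

Lemma follows_admissible s x : (forall n, follows s n x) -> admissible s.
Proof.
move=> h n; rewrite -ctr_adj; have sr : r < sigma (s n) * r by rewrite ltr_pMl.
apply: (abs_trans_lt K_padic (y := iter n.+1 f x)).
  by rewrite (abs_distC K_padic); apply: lt_trans sr; exact: h.
have c0 : abs (ctr (s n) - ctr (s n)) < r by rewrite subrr (padic_abs0 K_padic).
by rewrite iterS (ctr_scale (h n) c0) ltr_pM2l //; exact: h.
Qed.

Lemma iter_scale s n x y :
  (forall k, (k < n)%N -> follows s k x) -> (forall k, (k < n)%N -> follows s k y) ->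
  abs (iter n f x - iter n f y) = (\prod_(k < n) sigma (s k)) * abs (x - y).
Proof.
move=> hx hy; elim: n hx hy => [|n IH] hx hy; first by rewrite big_ord0 mul1r.
rewrite !iterS (@ctr_scale (s n)); [|exact: hx|exact: hy].
rewrite IH; first by rewrite big_ord_recr /= mulrCA mulrA.
  by move=> k kn; apply: hx; rewrite ltnW.
by move=> k kn; apply: hy; rewrite ltnW.
Qed.

Lemma prod_sigma_ge s n : p%:R ^+ n <= \prod_(k < n) sigma (s k).
Proof.
elim: n => [|n IH]; first by rewrite big_ord0.
rewrite big_ord_recr exprSr /= ler_pM // ?exprn_ge0 //; exact: ltW (primeR_gt0 K_padic).
Qed.

Lemma prod_sigma_gt0 s n : 0 < \prod_(k < n) sigma (s k).
Proof. by apply: prodr_gt0. Qed.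

Lemma follows_close s n x y : (forall k, (k <= n)%N -> follows s k x) ->
  (forall k, (k <= n)%N -> follows s k y) -> abs (x - y) <= r / p%:R ^+ n.
Proof.
move=> hx hy; have pn : 0 < p%:R ^+ n :> R by rewrite exprn_gt0 // (primeR_gt0 K_padic).
rewrite ler_pdivlMr // mulrC.
apply: (@le_trans _ _ (\prod_(k < n) sigma (s k) * abs (x - y))).
  by rewrite ler_wpM2r ?(abs_ge0 K_padic) // prod_sigma_ge.
rewrite -iter_scale; [|by move=> k /ltnW; exact: hx|by move=> k /ltnW; exact: hy].
apply/ltW/(abs_trans_lt K_padic (y := ctr (s n))); first exact: hx.
by rewrite (abs_distC K_padic); exact: hy.
Qed.

Lemma follows_inj s x y : (forall n, follows s n x) -> (forall n, follows s n y) -> x = y.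
Proof.
move=> hx hy; apply/eqP; rewrite -subr_eq0; apply/eqP.
apply: (abs_eq0P K_padic) => e e0; have [n hn] := geometric_small K_padic r e0.
by apply: le_lt_trans hn; apply: (follows_close (s := s)).
Qed.

(** Following an itinerary up to time n is an open condition with explicit radius; this carries
    itineraries over to limits. *)
Lemma follows_shadow s n x y : (forall k, (k <= n)%N -> follows s k x) ->
  (\prod_(k < n) sigma (s k)) * abs (y - x) < r -> forall k, (k <= n)%N -> follows s k y.
Proof.
elim: n s x y => [|n IH] s x y hx.
  rewrite big_ord0 mul1r => h [|//] _; exact: (abs_trans_lt K_padic h (hx 0%N isT)).
rewrite big_ord_recl => h; have h0 : abs (y - ctr (s 0%N)) < r.
  apply: (abs_trans_lt K_padic (y := x)); last exact: (hx 0%N).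
  apply: le_lt_trans h; rewrite ler_peMl ?(abs_ge0 K_padic) //.
  apply: mulr_ege1; first exact: ltW.
  apply: le_trans (prod_sigma_ge (fun k => s k.+1) n).
  by rewrite exprn_ege1 // ltW // (primeR_gt1 K_padic).
case=> [//|k] kn; rewrite followsS; apply: (IH _ (f x)) => //.
  by move=> j jn; rewrite -followsS; apply: hx.
rewrite (@ctr_scale (s 0%N)) //; last exact: (hx 0%N).
by move: h; rewrite mulrA [X in X * _]mulrC.
Qed.

Lemma follows_exists s n : admissible s -> exists x, forall k, (k <= n)%N -> follows s k x.
Proof.
elim: n s => [|n IH] s hs.
  by exists (ctr (s 0%N)) => -[|//] _; rewrite /follows /= subrr (padic_abs0 K_padic).
have [|z hz] := IH (fun k => s k.+1); first by move=> k; exact: hs.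
have [|x hx ex] := @ctr_onto (s 0%N) z.
  apply: (abs_trans_lt K_padic (y := ctr (s 1%N))); last by rewrite ctr_adj; exact: hs.
  by apply: lt_trans (hz 0%N isT) _; rewrite ltr_pMl.
by exists x => -[//|k] kn; rewrite followsS ex; exact: hz.
Qed.

Lemma follows_surj s : admissible s -> exists x, forall n, follows s n x.
Proof.
move=> hs; have /choice[u hu] : forall n, exists x, forall k, (k <= n)%N -> follows s k x.
  by move=> n; exact: follows_exists.
have [n|l hl] := @geometric_cvg _ _ _ _ K_padic u r.
  by apply: (follows_close (s := s)) => k kn; apply: hu; rewrite // leqW.
exists l => n; pose P := \prod_(k < n) sigma (s k).
have P0 : 0 < P by exact: prod_sigma_gt0.
(* [N] makes the approximation error smaller than the shadowing radius r / P for time n. *)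
have [N hN] := geometric_small K_padic r (divr_gt0 r_gt0 P0).
apply: (follows_shadow (n := n) (x := u (maxn n N))) => // [k kn|].
  by apply: hu; rewrite (leq_trans kn) // leq_maxl.
rewrite -/P mulrC -ltr_pdivlMr //; apply: le_lt_trans hN.
rewrite (abs_distC K_padic); apply: le_trans (hl _) _.
have p0 k : 0 < p%:R ^+ k :> R by rewrite exprn_gt0 // (primeR_gt0 K_padic).
by rewrite ler_pM2l // lef_pV2 ?posrE // ler_eXn2l ?(primeR_gt1 K_padic) // leq_maxr.
Qed.

(** The symbol [i0] only serves to code points that leave the pieces. *)
Lemma coding (i0 : I) : exists h : K -> nat -> I,
  [/\ forall x, survivors x -> forall n, follows (h x) n x,
      forall x, survivors x -> admissible (h x),
      forall x, survivors x -> forall n, h (f x) n = h x n.+1,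
      forall x y, survivors x -> survivors y -> h x = h y -> x = y &
      forall s, admissible s -> exists2 x, survivors x & h x = s].
Proof.
have /choice[h hh] : forall x, exists s, survivors x -> forall n, follows s n x.
  move=> x; have [hx|hx] := pselect (survivors x).
    by have /choice[s hs] := hx; exists s.
  by exists (fun=> i0).
have sf x : survivors x -> survivors (f x).
  by move=> hx n; have [i hi] := hx n.+1; exists i; rewrite -iterSr.
have surv s x : (forall n, follows s n x) -> survivors x by move=> hs n; exists (s n); exact: hs.
exists h; split.
- exact: hh.
- by move=> x hx; apply: (follows_admissible (x := x)); exact: hh.
- move=> x hx n; apply: (ball_sep (x := iter n f (f x))); first exact: (hh _ (sf _ hx)).
  by rewrite -iterSr; exact: (hh _ hx).
- by move=> x y hx hy e; apply: (follows_inj (s := h x)) => n; [exact: hh|rewrite e; exact: hh].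
- move=> s hs; have [x hx] := follows_surj hs; exists x; first exact: surv hx.
  by apply/funext => n; apply: (ball_sep (x := iter n f x)); [exact: (hh _ (surv _ _ hx))|exact: hx].
Qed.

(** At the first disagreement the two iterates lie in distinct pieces, so their distance is exactly
    that of the centers. This exactness makes the coding an isometry for [d_f]. *)
Lemma coding_dist s t x y n : (forall k, follows s k x) -> (forall k, follows t k y) ->
  (forall k, (k < n)%N -> s k = t k) -> s n != t n ->
  (\prod_(k < n) sigma (s k)) * abs (x - y) = abs (ctr (s n) - ctr (t n)).
Proof.
move=> hx hy est ne; have hy' k : (k < n)%N -> follows s k y.
  by move=> kn; rewrite /follows est //; exact: hy.
rewrite -(iter_scale (fun k _ => hx k) hy').
rewrite (_ : iter n f x - iter n f y = (ctr (s n) - ctr (t n)) +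
  ((iter n f x - ctr (s n)) - (iter n f y - ctr (t n)))); last by ring.
apply: (absD_dom K_padic); apply: lt_le_trans (ctr_sep ne).
by apply: (absB_lt K_padic); [exact: hx|exact: hy].
Qed.

End Coding.

(** * The subshift and the full shift on three symbols *)

Section Shift.

Lemma symb_nbhs_cylinder (n : nat) (x : symb_seq n) (N : nat) :
  nbhs x [set y : symb_seq n | forall j, (j < N)%N -> y j = x j].
Proof.
elim: N => [|N IH]; first by apply: filterS filterT => y _ j.
have hN : nbhs x [set y : symb_seq n | y N = x N].
  have := @proj_continuous nat (fun=> discrete_topology 'I_n) N x.
  by move=> /(_ _ (discrete_set1 (x N))).
apply: filterS (filterI IH hN) => y [h1 h2] j; rewrite ltnS leq_eqVlt => /predU1P[->//|].
exact: h1.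
Qed.

Lemma prod_topology_continuous (T : topologicalType) (I : eqType)
  (K : I -> topologicalType) (F : T -> prod_topology K) :
  (forall i, continuous (fun x => F x i)) -> continuous F.
Proof.
move=> cF x; apply/cvg_sup => i; move: x.
apply/(@continuousP _ (initial_topology (@^~ i))) => A [B oB <-].
by apply: (@open_comp _ _ (fun x => F x i)) => // + _; exact: cF.
Qed.

Lemma symb_continuous (n l : nat) (F : symb_seq n -> symb_seq l) :
  (forall k, exists N, forall x y : symb_seq n,
     (forall j, (j < N)%N -> x j = y j) -> F x k = F y k) -> continuous F.
Proof.
move=> FN; apply: (@prod_topology_continuous _ _ (fun=> discrete_topology 'I_l)) => k x U /nbhs_singleton UFx; have [N hN] := FN k.
have : nbhs x [set y : symb_seq n | U (F y k)].
  by apply: filterS (symb_nbhs_cylinder x N) => y hy; rewrite /= (hN y x).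
exact.
Qed.

Lemma mx_exp_pos (n : nat) (A : 'M[nat]_n.+1) k l i j i' :
  (0 < (A ^+ k) i j)%N -> (0 < (A ^+ l) j i')%N -> (0 < (A ^+ (k + l)) i i')%N.
Proof.
move=> hk hl; rewrite exprD mxE (bigD1 j) //=.
rewrite -[X in (_ < X)%N]/(((A ^+ k) i j * (A ^+ l) j i')%N + _)%N.
by rewrite addn_gt0 muln_gt0 hk hl.
Qed.

Variable m : nat.
Hypothesis m_gt0 : (0 < m)%N.

Lemma potts_mxE i j : potts_mx m i j = adj m i j.
Proof. by rewrite mxE /adj; case: ifP => // _; case: ifP. Qed.

(** Every index below m moves up by one, every index from m on leads to C_2, and C_2 leads
    everywhere. *)
Lemma potts_irreducible : irreducible_mx (potts_mx m).
Proof.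
have hC : (m.+1 < m.+3)%N by []; pose C := Ordinal hC.
have adjP (i j : 'I_m.+3) : adj m i j -> (0 < (potts_mx m ^+ 1) i j)%N.
  by rewrite expr1 potts_mxE => ->.
have toC k : forall i : 'I_m.+3, (m <= i + k)%N ->
    exists2 n, (0 < n)%N & (0 < (potts_mx m ^+ n) i C)%N.
  elim: k => [|k IH] i hi; have [mi|im] := leqP m i.
  - exists 1%N => //; apply: adjP; rewrite /adj ltnNge mi /=; by case: ifP.
  - by move: hi; rewrite addn0 leqNgt im.
  - exists 1%N => //; apply: adjP; rewrite /adj ltnNge mi /=; by case: ifP.
  have hj : (i.+1 < m.+3)%N by move: im; clear; lia.
  have [|n n0 hn] := IH (Ordinal hj); first by rewrite /= addSnnS.
  exists n.+1 => //; apply: (mx_exp_pos (k := 1) (j := Ordinal hj)) => //.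
  by apply: adjP; rewrite /adj im /= eqxx orbT.
move=> i j; have [n n0 hn] := toC m i (leq_addl _ _).
exists (n + 1)%N; first by rewrite addn1.
apply: mx_exp_pos hn _; apply: adjP; rewrite /adj /=.
by rewrite ltnNge leqnSn /= gtn_eqF.
Qed.

(* The three symbols are {D_1, H_m, ..., H_1}, C_2 and C_3. Between two visits of
   C_2 or C_3 the orbit is forced to run through ..., D_1, H_m, ..., H_1, so the
   first symbol is recovered from the waiting time, cut off at [m.+1]. *)
Definition merge_symbols (x : symb_seq m.+3) : symb_seq 3 := fun k => inord (x k - m).

Fixpoint wait (n : nat) (b : nat -> bool) (k : nat) : nat :=
  if n is n'.+1 then if b k then 0%N else (wait n' b k.+1).+1 else 0%N.

(** A nonzero symbol u is decoded as m + u. A symbol 0 at waiting time d is decoded as m + 1 - d, so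
    D_1 appears exactly when the cap is reached. *)
Definition split_symbols (y : symb_seq 3) : symb_seq m.+3 := fun k =>
  let d := wait m.+1 (fun j => y j != 0%N :> nat) k in
  inord (if d == 0%N then (m + y k)%N else (m.+1 - d)%N).

Lemma wait_le n b k : (wait n b k <= n)%N.
Proof. by elim: n k => //= n IH k; case: ifP => // _; rewrite ltnS. Qed.

Lemma waitS n b k : wait n b k = minn n (wait n.+1 b k).
Proof.
elim: n k => [|n IH] k; first by rewrite min0n.
rewrite [LHS]/= [wait n.+2 b k]/=; case: ifP => _; first by rewrite minn0.
by rewrite IH -minnSS.
Qed.

Lemma wait_eq n b c k : (forall j, (j < k + n)%N -> b j = c j) -> wait n b k = wait n c k.
Proof.
elim: n k => //= n IH k h; rewrite h; last by rewrite -[X in (X < _)%N]addn0 ltn_add2l.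
by case: ifP => // _; rewrite (IH k.+1) // => j hj; apply: h; rewrite -addSnnS.
Qed.

Lemma subshiftP (x : symb_seq m.+3) : subshift (potts_mx m) x <-> forall k, adj m (x k) (x k.+1).
Proof.
by split=> h k; have := h k; rewrite potts_mxE; case: adj.
Qed.

Lemma merge_lt i : (i < m.+3)%N -> (i - m < 3)%N.
Proof. by clear; lia. Qed.

(** From a symbol u with 0 < u <= m the exit takes exactly m + 1 - u steps. From 0 it may take
    longer because of the loop at D_1, which the cap n <= m + 1 hides. *)
Lemma wait_subshift (x : symb_seq m.+3) n k : subshift (potts_mx m) x -> (n <= m.+1)%N ->
  wait n (fun j => (m < x j)%N) k = minn n (m.+1 - x k).
Proof.
move=> /subshiftP hx; elim: n k => [|n IH] k nm; first by rewrite min0n.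
rewrite [LHS]/=; case: ifP => hk; first by move: hk; clear; lia.
rewrite IH 1?ltnW //; move: (hx k) hk nm m_gt0; rewrite /adj.
move: (nat_of_ord (x k)) (nat_of_ord (x k.+1)) => u v; clear.
by case: (ltngtP u m) => ?; lia.
Qed.

Lemma split_lt (y : symb_seq 3) k :
  ((if wait m.+1 (fun j => y j != 0%N :> nat) k == 0%N then m + y k
    else m.+1 - wait m.+1 (fun j => y j != 0%N :> nat) k) < m.+3)%N.
Proof. by case: ifP => _; have := ltn_ord (y k); clear; lia. Qed.

Lemma wait_eq0 n b k : (wait n.+1 b k == 0%N) = b k.
Proof. by rewrite /=; case: ifP. Qed.

(** At a symbol 0 the waiting time is one more than the next one capped at m; the cap produces the
    loop at D_1, the other values the steps i to i + 1. *)
Lemma split_subshift y : subshift (potts_mx m) (split_symbols y).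
Proof.
apply/subshiftP => k; rewrite !inordK ?split_lt //.
set b := (fun j => y j != 0%N :> nat).
have wS : wait m.+1 b k = if b k then 0%N else (wait m b k.+1).+1 by [].
have := wait_eq0 m b k.+1; have := wait_le m.+1 b k.+1; have := waitS m b k.+1.
rewrite wS /b; move: (ltn_ord (y k)) (ltn_ord (y k.+1)) m_gt0; rewrite /adj.
move: (wait m.+1 b k.+1) (wait m b k.+1) (nat_of_ord (y k)) (nat_of_ord (y k.+1)).
by clear; move=> d' e u v; case: (eqVneq u 0%N) => ?; case: (eqVneq d' 0%N) => ? /=;
  do 2?[case: ifP]; lia.
Qed.

Lemma merge_continuous : continuous merge_symbols.
Proof.
by apply: symb_continuous => k; exists k.+1 => x y h; rewrite /merge_symbols h.
Qed.

Lemma split_continuous : continuous split_symbols.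
Proof.
apply: symb_continuous => k; exists (k + m.+1)%N => x y h; rewrite /split_symbols.
rewrite (@wait_eq _ _ (fun j => y j != 0%N :> nat)); last by move=> j /h ->.
by rewrite h // -[X in (X < _)%N]addn0 ltn_add2l.
Qed.

Lemma mergeK x : subshift (potts_mx m) x -> split_symbols (merge_symbols x) = x.
Proof.
move=> hx; apply/funext => k; apply: ord_inj; rewrite inordK ?split_lt //.
have mE j : (merge_symbols x j : nat) = (x j - m)%N by rewrite inordK // merge_lt.
rewrite (@wait_eq _ _ (fun j => (m < x j)%N)); last first.
  by move=> j _; rewrite mE subn_eq0 -ltnNge.
rewrite wait_subshift // mE; move: (ltn_ord (x k)); move: (nat_of_ord (x k)) => u; clear.
by case: ifP; lia.
Qed.

Lemma splitK y : merge_symbols (split_symbols y) = y.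
Proof.
apply/funext => k; apply: ord_inj; rewrite inordK ?merge_lt // inordK ?split_lt //.
have := wait_eq0 m (fun j => y j != 0%N :> nat) k.
move: (wait _ _ k) (nat_of_ord (y k)) m_gt0 => d u; clear.
by case: ifP; lia.
Qed.

Lemma potts_full_shift : topologically_conjugate
  (subshift (potts_mx m)) (@left_shift m.+3) [set: symb_seq 3] (@left_shift 3).
Proof.
split=> //; first by move=> _ [x hx <-] k; exact: hx.
exists merge_symbols, split_symbols; split=> //.
- by split=> // _ [y _ <-]; exact: split_subshift.
- by split=> [x|y _]; [exact: mergeK|exact: splitK].
- exact/continuous_subspaceT/merge_continuous.
- exact/continuous_subspaceT/split_continuous.
Qed.

End Shift.

(** * The pieces in the p-adic numbers *)

Section FieldIdentities.
Variable K : fieldType.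
Implicit Types (theta q x y S P C : K).

Lemma potts_bethe_mobius theta q x : x != 1 + (1 - theta - q) ->
  ((theta * x + q - 1) / (x + theta + q - 2)) ^+ 3 =
  (theta + (theta - 1) * (1 - theta - q) / (x - (1 + (1 - theta - q)))) ^+ 3.
Proof.
rewrite -subr_eq0 => x0; congr (_ ^+ 3).
rewrite (_ : x + theta + q - 2 = x - (1 + (1 - theta - q))); last by ring.
by field.
Qed.

Lemma xinf_shift theta q : 2 - theta - q = 1 + (1 - theta - q).
Proof. by ring. Qed.

Lemma xfix_shift theta q y :
  1 - q + (theta - 1) * (y - 1) = 1 + (1 - theta - q) + (theta - 1) * y.
Proof. by ring. Qed.

Lemma cubic_factor S P C y1 y2 y3 :
  S = y1 + y2 + y3 -> P = - (y1 * y2 + y1 * y3 + y2 * y3) -> C = y1 * y2 * y3 ->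
  'X^3 - S%:P * 'X^2 - P%:P * 'X - C%:P = ('X - y1%:P) * ('X - y2%:P) * ('X - y3%:P).
Proof. by move=> -> -> ->; rewrite !(polyCD, polyCN, polyCM); ring. Qed.

Lemma cubic_factor_horner S P C y1 y2 y3 :
  'X^3 - S%:P * 'X^2 - P%:P * 'X - C%:P = ('X - y1%:P) * ('X - y2%:P) * ('X - y3%:P) ->
  forall y, y ^+ 3 - S * y ^+ 2 - P * y - C = (y - y1) * (y - y2) * (y - y3).
Proof. by move=> e y; have := congr1 (horner^~ y) e; rewrite !hornerE. Qed.

Lemma sub_recenter x y S P : x - y = (S - P) + ((x - S) - (y - P)).
Proof. by ring. Qed.

End FieldIdentities.

Lemma exprM_cvg0 (R : realType) (z C : R) :
  `|z| < 1 -> z ^+ n * C @[n --> \oo] --> (0 : R).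
Proof.
by move=> z1; rewrite -[X in _ --> X](mul0r C); apply: cvgMr_tmp; apply: cvg_expr.
Qed.

(** * From real exponents to integer powers *)

Section RealExponents.
Variables (R : realType) (T Q : R) (m : nat).
Hypotheses (m_gt0 : (1 <= m)%N) (T_ge0 : 0 <= T) (Q_ge0 : 0 <= Q).
Hypotheses (Qpos : 0 < Q `^ (m.+1%:R / m%:R)) (QT : Q `^ (m.+1%:R / m%:R) <= T).
Hypotheses (TQ : T < Q `^ (m.+2%:R / m.+1%:R)) (Q_small : Q `^ (m.+2%:R / m.+1%:R) < 1).

Lemma powR_ratioX (x : R) (k l : nat) : 0 <= x -> (0 < l)%N ->
  (x `^ (k%:R / l%:R)) ^+ l = x ^+ k.
Proof.
by move=> x0 l0; rewrite -powR_mulrn ?powR_ge0 // -powRrM divfK ?powR_mulrn // pnatr_eq0 -lt0n.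
Qed.

Lemma powR_Q_gt0 : 0 < Q.
Proof.
rewrite lt_neqAle Q_ge0 andbT eq_sym; apply/eqP => Q0; move: Qpos.
rewrite Q0 powR0 ?ltxx // mulf_eq0 invr_eq0 !pnatr_eq0 negb_or /=.
by rewrite -lt0n.
Qed.

Lemma powR_T_gt0 : 0 < T. Proof. exact: lt_le_trans QT. Qed.

Lemma powR_Q_lt1 : Q < 1.
Proof.
rewrite ltNge; apply/negP => Q1; move: Q_small; rewrite ltNge => /negP[].
by rewrite -[X in X <= _](powRr0 Q); apply: ler_powR; rewrite ?divr_ge0 ?ler0n.
Qed.

Lemma QX_le_TX : Q ^+ m.+1 <= T ^+ m.
Proof. by rewrite -(@powR_ratioX Q m.+1 m) // lerXn2r // nnegrE powR_ge0. Qed.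

Lemma TX_lt_QX : T ^+ m.+1 < Q ^+ m.+2.
Proof. by rewrite -(@powR_ratioX Q m.+2 m.+1) // ltrXn2r // nnegrE powR_ge0. Qed.

Lemma powR_T_lt_Q : T < Q.
Proof.
rewrite ltNge; apply/negP => h; have := TX_lt_QX; rewrite ltNge => /negP[].
apply: le_trans (_ : Q ^+ m.+1 <= _); last by rewrite lerXn2r // nnegrE.
by rewrite ler_wiXn2l // ltW // powR_Q_lt1.
Qed.

(** Raising the hypothesis to the power m clears its real exponent, and division by Q^m brings in
    lam; [ratioX_lt_Q] does the same with m + 1. *)
Lemma Q_le_ratioX : Q <= (T / Q) ^+ m.
Proof.
by rewrite expr_div_n ler_pdivlMr ?exprn_gt0 ?powR_Q_gt0 // -exprS QX_le_TX.
Qed.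

Lemma ratioX_lt_Q : (T / Q) ^+ m.+1 < Q.
Proof.
by rewrite expr_div_n ltr_pdivrMr ?exprn_gt0 ?powR_Q_gt0 // -exprS TX_lt_QX.
Qed.

End RealExponents.

Section SymbolicDistance.
Variables (R : realType) (p : nat).

Lemma first_diffP n (s t : symb_seq n) : s <> t ->
  s (Defs.first_diff s t) != t (Defs.first_diff s t) /\
  forall j, (j < Defs.first_diff s t)%N -> s j = t j.
Proof.
move=> st; have ex : exists k, s k != t k.
  apply: contrapT => h; apply: st; apply/funext => k; apply/eqP; apply: contraT => hk.
  by case: h; exists k.
suff /(xgetPex 0%N)[hk hj] : exists k, s k <> t k /\ forall j, (j < k)%N -> s j = t j.
  by split; [exact/eqP|exact: hj].
case: (ex_minnP ex) => k hk kmin; exists k; split; first exact/eqP.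
by move=> j jk; apply/eqP; apply: contraT => /kmin; rewrite leqNgt jk.
Qed.

Lemma pexponentP (z : R) : (exists k : int, z = p%:R ^ k) -> p%:R ^ pexponent p z = z.
Proof. by move=> [k hk]; rewrite /pexponent; case: xgetP => [l _ <-//|/(_ k)]. Qed.

Lemma exprz_sum n (x : R) (F : 'I_n -> int) : x != 0 ->
  x ^ (\sum_(j < n) F j) = \prod_(j < n) x ^ F j.
Proof.
by move=> x0; apply: (big_morph (fun k : int => x ^ k)) => // k l; rewrite expfzDr.
Qed.

End SymbolicDistance.

(** * Coding and decomposition for the Potts-Bethe mapping on Q_p *)

Section PottsBetheQp.
Variables (R : realType) (p : nat) (hp : prime p).
Hypothesis hp3 : (p = 1 %[mod 3])%N.
Local Notation K := (Qp hp).
Local Notation abs := (@pabs p hp R).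
Let K_padic : padic_abs p abs := pabs_padic R hp.
Variables (theta q : K).
Local Notation c := (1 - theta - q).
Local Notation xi := (1 + c).
Local Notation f := (potts_bethe theta q).
Local Notation r := (abs c * abs (theta - 1)).
Local Notation lam := (abs (theta - 1) / abs c).
Hypotheses (T_gt0 : 0 < abs (theta - 1)) (TQ : abs (theta - 1) < abs c).
Hypotheses (Q_lt1 : abs c < 1) (cq : abs c = abs q).
Implicit Types (x y z : K).

Lemma xinfE : xinf theta q = xi.
Proof. exact: xinf_shift. Qed.

Lemma xfixE y : xfix theta q y = xi + (theta - 1) * y.
Proof. exact: xfix_shift. Qed.

Lemma radiusE : Defs.radius R theta q = r.
Proof. by rewrite /Defs.radius -cq. Qed.

Let r_gt0 : 0 < r. Proof. by rewrite mulr_gt0 // (lt_trans T_gt0). Qed.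

Let lam_ge0 : 0 <= lam.
Proof. by rewrite ltW // divr_gt0 // (lt_trans T_gt0). Qed.

Let lam_lt1 : lam < 1.
Proof. by rewrite ltr_pdivrMr ?mul1r // (lt_trans T_gt0). Qed.

Let fE x : x != xi -> f x = (theta + (theta - 1) * c / (x - xi)) ^+ 3.
Proof. exact: potts_bethe_mobius. Qed.

Let c_neq0 : c != 0.
Proof. by rewrite -(abs_eq0 K_padic) gt_eqF // (lt_trans T_gt0). Qed.

Lemma labelled_roots_exist : exists y1 y2 y3, labelled_roots R theta q y1 y2 y3.
Proof.
have [y1 [y2 [y3 [n1 n2 n3 [eS eP eC]]]]] :=
  cubic_roots K_padic hp3 (lt_trans TQ Q_lt1) c_neq0 Q_lt1.
exists y1, y2, y3; split=> //; last by rewrite n2 n3.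
  exact: cubic_factor.
by rewrite n2.
Qed.

Variables (y1 y2 y3 : K).
Hypothesis hy : labelled_roots R theta q y1 y2 y3.
Local Notation x1 := (xfix theta q y1).
Local Notation x2 := (xfix theta q y2).
Local Notation x3 := (xfix theta q y3).

Let cubicE : forall y,
  y ^+ 3 - (1 + theta + theta ^+ 2) * y ^+ 2 - (2 * theta + 1) * c * y - c ^+ 2 =
  (y - y1) * (y - y2) * (y - y3).
Proof. by case: hy => e _ _ _ _; exact: cubic_factor_horner e. Qed.

Let n1 : abs y1 = 1. Proof. by case: hy. Qed.
Let n3 : abs y3 = abs c. Proof. by case: hy. Qed.
Let n2 : abs y2 = abs c. Proof. by case: hy => _ _ _ -> ->. Qed.

Let xfix_dist y : abs (xfix theta q y - xi) = abs (theta - 1) * abs y.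
Proof. by rewrite xfixE addrAC subrr add0r (padic_absM K_padic). Qed.

Let neq0_of_abs y (e : R) : 0 < e -> abs y = e -> y != 0.
Proof. by move=> e0 h; rewrite -(abs_eq0 K_padic) h gt_eqF. Qed.

Let fixed y : y != 0 -> (y - y1) * (y - y2) * (y - y3) = 0 -> f (xfix theta q y) = xfix theta q y.
Proof. by move=> y0 e; rewrite xfixE; apply: (xfix_fixed K_padic T_gt0 fE y0); rewrite cubicE. Qed.

Let fx1 : f x1 = x1.
Proof. by apply: fixed; [exact: neq0_of_abs ltr01 n1|rewrite subrr !mul0r]. Qed.
Let fx2 : f x2 = x2.
Proof.
by apply: fixed; [exact: neq0_of_abs (lt_trans T_gt0 TQ) n2|rewrite subrr mulr0 mul0r].
Qed.
Let fx3 : f x3 = x3.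
Proof. by apply: fixed; [exact: neq0_of_abs (lt_trans T_gt0 TQ) n3|rewrite subrr mulr0]. Qed.
Let x1T : abs (x1 - xi) = abs (theta - 1). Proof. by rewrite xfix_dist n1 mulr1. Qed.
Let x2r : abs (x2 - xi) = r. Proof. by rewrite xfix_dist n2 mulrC. Qed.
Let x3r : abs (x3 - xi) = r. Proof. by rewrite xfix_dist n3 mulrC. Qed.

Let x23 : abs (x2 - x3) = r.
Proof.
have [eS eP eC] := cubic_coefs K_padic hp3 cubicE.
rewrite !xfixE opprD addrACA subrr add0r -mulrBr (padic_absM K_padic) mulrC.
by rewrite (cubic_root_gap K_padic hp3 (lt_trans TQ Q_lt1) c_neq0 Q_lt1 eS eP eC n1 n2 n3).
Qed.

Lemma exists_backward_orbit : exists a : nat -> K, a 0%N = x2 /\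
  forall l, abs (a l.+1 - x1) < abs (theta - 1) /\ f (a l.+1) = a l.
Proof. exact: (backward_orbit K_padic hp3 T_gt0 TQ Q_lt1 fE fx1 x1T x2r). Qed.

Variables (a : nat -> K) (m : nat).
Hypotheses (a0 : a 0%N = x2) (aT : forall l, abs (a l.+1 - x1) < abs (theta - 1))
  (fa : forall l, f (a l.+1) = a l).
Hypotheses (m_gt0 : (0 < m)%N) (Qlam : abs c <= lam ^+ m) (lamQ : lam ^+ m.+1 < abs c).
Local Notation ball := (@pball R p hp (Defs.radius R theta q)).
Local Notation cen := (ctr x3 a m).
Local Notation sc := (scale abs theta c m).
Local Notation attracting := (attracting_pieces abs theta c x3 a m).

Lemma ballP b x : ball b x <-> abs (x - b) < r.
Proof. by rewrite /pball /= radiusE. Qed.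

Lemma ball_center b b' : abs (b - b') < r -> ball b = ball b'.
Proof.
move=> h; apply/seteqP; split=> x /ballP hx; apply/ballP; apply: (abs_trans_lt K_padic hx) => //.
by rewrite (abs_distC K_padic).
Qed.

Lemma ball_self b : ball b b.
Proof. by apply/ballP; rewrite subrr (padic_abs0 K_padic). Qed.

Lemma piece_CE y : abs (xfix theta q y - xi) = r -> piece_C R theta q y = ball (xfix theta q y).
Proof.
move=> hyr; apply/seteqP; split=> x; rewrite /piece_C /= xinfE radiusE.
  by move=> [h e]; rewrite -e.
move=> h; have e : abs (x - xi) = r.
  by rewrite -hyr; apply: (abs_close_dist K_padic); rewrite hyr.
by rewrite e.
Qed.

(** Uniqueness: any candidate ball has x^(2) in its l-th image, so by [a_unique] it contains [a l]
    and is the ball around it. *)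
Lemma piece_HE l : (0 < l)%N -> (l <= m)%N -> piece_H R theta q y1 y2 y3 l = ball (a l).
Proof.
move=> l0 lm.
have Gsphere x : sphere_G R theta q y1 l x <-> abs (x - x1) = abs (theta - 1) * lam ^+ l.
  by rewrite /sphere_G /= -cq exprS expr_div_n mulrA.
have lamr : lam ^+ l * r < r.
  by rewrite gtr_pMl // exprn_ilt1 ?lam_lt1 ?lam_ge0 // -lt0n.
apply: xget_unique; last first.
  move=> S [[b ->] hS hC].
  have [x [bx xdef] ex] : iter_image theta q l (ball b) x2.
    by apply: hC; left; rewrite piece_CE //; exact: ball_self.
  have -> : a l = x.
    apply/esym/(a_unique K_padic hp3 T_gt0 TQ Q_lt1 fE fx1 x1T a0 aT fa) => //.
    by apply/Gsphere; exact: hS.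
  by apply: ball_center; rewrite (abs_distC K_padic); apply/ballP.
split; first by exists (a l).
  move=> x /ballP hx; apply/Gsphere.
  exact: (a_sphere K_padic hp3 T_gt0 TQ Q_lt1 fE fx1 x1T x2r a0 aT fa Qlam lm).
rewrite !piece_CE // => z hz.
have [|x [hx ex dx]] :=
  @a_pullback _ _ _ _ K_padic hp3 _ _ _ T_gt0 TQ Q_lt1 fE _ _ fx1 x1T x2r _ a0 aT fa l z.
  case: hz => /ballP hz; first exact: ltW.
  by apply: (abs_trans_le K_padic (ltW hz)); rewrite (abs_distC K_padic) x23.
exists x => //; split; first by apply/ballP; exact: le_lt_trans lamr.
by move=> k kl; rewrite xinfE; apply/eqP/(near_x1_neq_xi K_padic x1T)/dx.
Qed.

Lemma piece_DE : piece_D R theta q y1 = ball (a m.+1).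
Proof.
rewrite /piece_D; apply: ball_center; rewrite (abs_distC K_padic).
rewrite (a_x1_dist K_padic hp3 T_gt0 TQ Q_lt1 fE fx1 x1T x2r a0 aT fa).
by rewrite [_ * abs _]mulrC ltr_pM2l.
Qed.

Lemma pieceE (i : 'I_m.+3) : piece R theta q y1 y2 y3 i = ball (cen i).
Proof.
rewrite /piece /ctr; case: eqP => [->|/eqP i0]; first exact: piece_DE.
case: ifP => im; first by rewrite leqW // piece_HE //; move: i0 im; clear; lia.
case: eqP => [->|/eqP im1]; first by rewrite leqnn subnn a0 piece_CE.
have -> : (i <= m.+1)%N = false by move: im im1; clear; lia.
by rewrite piece_CE.
Qed.

Let cen_scale i x y : abs (x - cen i) < r -> abs (y - cen i) < r ->
  abs (f x - f y) = sc i * abs (x - y).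
Proof. exact: (ctr_scale K_padic hp3 T_gt0 TQ Q_lt1 fE fx1 fx2 fx3 x1T x2r x3r a0 aT). Qed.

Let cen_onto i z : abs (z - f (cen i)) < sc i * r -> exists2 x, abs (x - cen i) < r & f x = z.
Proof. exact: (ctr_onto K_padic hp3 T_gt0 TQ Q_lt1 fE fx1 fx2 fx3 x1T x2r x3r a0 aT fa). Qed.

Let cen_sep (i j : 'I_m.+3) : i != j -> r <= abs (cen i - cen j).
Proof.
move=> ij; apply: (ctr_sep K_padic hp3 T_gt0 TQ Q_lt1 fE fx1 x1T x2r x3r x23 a0 aT fa Qlam) => //.
- by rewrite -ltnS.
- by rewrite -ltnS.
Qed.

Let cen_adj (i j : 'I_m.+3) : (abs (cen j - f (cen i)) < sc i * r) = adj m i j.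
Proof.
apply: (ctr_adj K_padic hp3 T_gt0 TQ Q_lt1 fE fx1 fx2 fx3 x1T x2r x3r x23 a0 aT fa m_gt0 Qlam lamQ).
- by rewrite -ltnS.
- by rewrite -ltnS.
Qed.

Let sc_gt1 i : 1 < sc i.
Proof. exact: scale_gt1. Qed.

Let sc_gt0 i : 0 < sc i.
Proof. exact: lt_trans (sc_gt1 i). Qed.

Lemma XXE x : XX R theta q y1 y2 y3 m x <-> attracting x.
Proof.
rewrite piecesP /XX piece_DE !piece_CE // -a0; split.
  move=> [[[/ballP h|[l /= /andP[l0 lm]]]|/ballP h]|/ballP h].
  - by right; exists m.+1.
  - by rewrite piece_HE // => /ballP h; right; exists l => //; exact: leqW.
  - by right; exists 0%N.
  - by left.
move=> [/ballP h|[l lm /ballP h]]; first by right.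
have [l0|l0] := posnP l; first by left; right; rewrite -l0.
move: lm; rewrite leq_eqVlt => /predU1P[lm|lm]; first by left; left; left; rewrite -lm.
left; left; right; exists l; first by rewrite /= l0 -ltnS.
by rewrite piece_HE.
Qed.

Let attracting_neq_xinf x : attracting x -> x <> xinf theta q.
Proof.
by move=> h; rewrite xinfE; apply/eqP; apply: (pieces_neq_xi K_padic T_gt0 Q_lt1 x1T x2r x3r a0 aT h).
Qed.

Let attracting_cen x : attracting x <-> exists i : 'I_m.+3, abs (x - cen i) < r.
Proof.
split=> [[i im hx]|[i hx]]; last by exists i; rewrite // -ltnS.
by exists (Ordinal (im : (i < m.+3)%N)).
Qed.

(** No piece contains the pole, so staying in the pieces already makes all iterates defined. *)
Lemma JJE x : JJ R theta q y1 y2 y3 m x <-> survivors abs (fun i : 'I_m.+3 => cen i) r f x.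
Proof.
split=> h n; first by apply/attracting_cen/XXE; case: (h n I).
move=> _; split; last by apply/XXE/attracting_cen.
by move=> k _; apply/attracting_neq_xinf/attracting_cen.
Qed.

Lemma image_piece (i : 'I_m.+3) y : iter_image theta q 1 (ball (cen i)) y <-> abs (y - f (cen i)) < sc i * r.
Proof.
have c0 : abs (cen i - cen i) < r by rewrite subrr (padic_abs0 K_padic).
split=> [[x [/ballP hx _] <-]|hy']; first by rewrite /= (cen_scale hx c0) ltr_pM2l.
have [x hx ex] := cen_onto hy'; exists x => //; split; first exact/ballP.
by case=> // _; apply/attracting_neq_xinf/attracting_cen; exists i.
Qed.

(** The image of a piece is a ball of radius larger than r, so it contains another piece as soon as
    it contains its center. *)
Lemma incidenceE : incidence_mx R theta q y1 y2 y3 m = potts_mx m.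
Proof.
apply/matrixP => i j; rewrite mxE potts_mxE !pieceE -cen_adj; congr (nat_of_bool _).
apply/asboolP/idP => [h|h z /ballP hz].
  by apply/image_piece/h/ball_self.
apply/image_piece; apply: (abs_trans_lt K_padic _ h); apply: (lt_trans hz).
by rewrite ltr_pMl.
Qed.

Let sc_expz i : exists k : int, sc i = p%:R ^ k.
Proof.
rewrite /scale; case: ifP => _.
  have [|k hk] := padic_abs_expz K_padic (x := c / (theta - 1)).
    by rewrite mulf_neq0 // invr_eq0 -(abs_eq0 K_padic) gt_eqF.
  by exists k; rewrite -hk (abs_div K_padic) invf_div.
have [|k hk] := padic_abs_expz K_padic (x := (c * (theta - 1))^-1).
  by rewrite invr_eq0 mulf_neq0 // -(abs_eq0 K_padic) gt_eqF.
by exists k; rewrite -hk (absV K_padic) (padic_absM K_padic).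
Qed.

Let sc_ge i : p%:R <= sc i.
Proof.
have [k hk] := sc_expz i; have := sc_gt1 i; rewrite hk -{1}(expr0z p%:R).
rewrite -[X in _ -> X <= _]expr1z ltr_eXz2l ?(primeR_gt1 K_padic) //.
by rewrite ler_eXz2l ?(primeR_gt1 K_padic).
Qed.

Let p_neq0 : p%:R != 0 :> R.
Proof. by rewrite gt_eqF // (primeR_gt0 K_padic). Qed.

Lemma tauE (i : 'I_m.+3) : p%:R ^ tau R theta q i = sc i.
Proof.
rewrite /tau pexponentP; last first.
  have [k hk] := sc_expz i; exists k; rewrite -hk /scale -cq.
  by case: ifP => _; rewrite ?invf_div ?div1r.
by rewrite /scale -cq; case: ifP => _; rewrite ?invf_div ?div1r.
Qed.

Lemma centerE (i : 'I_m.+3) : abs (Defs.center R theta q y1 y2 y3 i - cen i) < r.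
Proof.
rewrite (abs_distC K_padic); apply/ballP; rewrite /Defs.center; case: xgetP => [b _|].
  by rewrite /= pieceE => <-; exact: ball_self.
by move=> /(_ (cen i)) []; rewrite /= pieceE.
Qed.

(** The chosen centers may differ from [cen], but by less than r, and distinct pieces are at least r
    apart. *)
Lemma kappaE (i j : 'I_m.+3) : i != j ->
  p%:R ^ (- Defs.kappa R theta q y1 y2 y3 i j) = abs (cen i - cen j).
Proof.
move=> ij; have sep := cen_sep ij.
have e : abs (Defs.center R theta q y1 y2 y3 i - Defs.center R theta q y1 y2 y3 j) =
    abs (cen i - cen j).
  move: (Defs.center _ _ _ _ _ _ i) (Defs.center _ _ _ _ _ _ j) (centerE i) (centerE j).
  move=> u v hu hv; rewrite (sub_recenter u v (cen i) (cen j)).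
  by apply: (absD_dom K_padic); apply: lt_le_trans sep; exact: (absB_lt K_padic).
rewrite /Defs.kappa opprK pexponentP e //; apply: (padic_abs_expz K_padic).
by rewrite -(abs_eq0 K_padic) gt_eqF // (lt_le_trans r_gt0).
Qed.

Lemma JJ_conjugate : isometrically_conjugate
  (JJ R theta q y1 y2 y3 m) f (fun x y => abs (x - y))
  (subshift (potts_mx m)) (@left_shift m.+3) (@d_f R p hp theta q y1 y2 y3 m).
Proof.
have [h [hfol hadm hshift hinj hsurj]] := @coding _ _ _ _ K_padic _
  (fun i : 'I_m.+3 => cen i) (fun i : 'I_m.+3 => sc i) r f (fun i j => adj m i j) r_gt0
  (fun i => sc_ge i) (fun i => @cen_scale i) (fun i => @cen_onto i) cen_sep cen_adj ord0.
split.
- move=> _ [x /JJE hx <-]; apply/JJE => n.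
  by have [i hi] := hx n.+1; exists i; rewrite -iterSr.
- by move=> _ [s hs <-] k; exact: hs.
exists (h : K -> symb_seq m.+3); split.
- split.
  + by move=> x /JJE hx; apply/subshiftP; exact: hadm.
  + by move=> x y; rewrite !inE => /JJE hx /JJE hy'; exact: hinj.
  + by move=> s /subshiftP hs; have [x hx ex] := hsurj s hs; exists x => //; apply/JJE.
- move=> x y /JJE hx /JJE hy'; rewrite /d_f /symb_dist; case: asboolP => [e|ne].
    by rewrite (hinj _ _ hx hy' e) subrr (padic_abs0 K_padic).
  have [ne' he] := first_diffP ne; move: (Defs.first_diff _ _) ne' he => k ne' he.
  have := @coding_dist _ _ _ _ K_padic _ (fun i : 'I_m.+3 => cen i) (fun i : 'I_m.+3 => sc i)
    r f (fun i => @cen_scale i) cen_sep _ _ _ _ _ (hfol _ hx) (hfol _ hy') he ne'.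
  rewrite expfzDr // kappaE // => <-; rewrite -invr_expz exprz_sum //.
  rewrite (eq_bigr (fun j : 'I_k => sc (h x j))) => [|j _]; last exact: tauE.
  by rewrite mulKf // gt_eqF // prodr_gt0.
- by move=> x /JJE hx; apply/funext => n; exact: hshift.
Qed.

Lemma complement_basin x : ~ attracting x -> (forall n, iter n f x != xi) ->
  abs (iter n f x - 1) @[n --> \oo] --> (0 : R).
Proof.
move=> nX xxi.
have [N hN] := escape_near1 K_padic hp3 T_gt0 TQ Q_lt1 fE fx1 fx2 fx3 x1T x2r x3r x23 a0 aT fa
  lamQ xxi nX.
rewrite -(cvg_shiftn N) /=.
rewrite (_ : (fun n => _) = fun n => lam ^+ n * abs (iter N f x - 1)); last first.
  by apply/funext => n; rewrite iterD (near1_iter K_padic hp3 T_gt0 TQ Q_lt1 fE _ hN).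
apply: exprM_cvg0.
by rewrite (ger0_norm lam_ge0); exact: lam_lt1.
Qed.

Lemma Qp_decomposition : [set: K] = basin R theta q 1 `|` JJ R theta q y1 y2 y3 m
    `|` \bigcup_n iter_preimage theta q n [set xinf theta q].
Proof.
apply/esym/seteqP; split=> // x _.
have [[n hn]|nxi] := pselect (exists n, iter n f x == xinf theta q).
  right; have := ex_intro (fun n => iter n f x == xinf theta q) n hn.
  (* Minimality of the hitting time makes all earlier iterates avoid the pole, as [iter_preimage]
     demands. *)
  move=> /ex_minnP[k /eqP hk kmin]; exists k => //; split=> // j jk ej.
  by have := kmin j; rewrite ej eqxx leqNgt jk => /(_ isT).
have xdef n : iter n f x <> xinf theta q by move=> e; apply: nxi; exists n; rewrite e.
left; have [hJ|hJ] := pselect (JJ R theta q y1 y2 y3 m x); [by right|left].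
have [n hn] : exists n, ~ attracting (iter n f x).
  apply: contrapT => h; apply: hJ; apply/JJE => n; apply/attracting_cen.
  by apply: contrapT => hn; apply: h; exists n.
split; first by move=> n' k _; exact: xdef.
rewrite -(cvg_shiftn n) /=.
rewrite (_ : (fun n' => _) = fun k => abs (iter k f (iter n f x) - 1)); last first.
  by apply/funext => k; rewrite iterD.
by apply: complement_basin => // k; rewrite -iterD -xinfE; apply/eqP.
Qed.

End PottsBetheQp.

Unset Implicit Arguments.
Set Strict Implicit.
Set Printing Implicit Defensive.

Theorem theorem4p15 (R : realType) (p : nat) (hp : prime p)
  (hp3 : (p = 1 %[mod 3])%N) (theta q : Qp hp)
  (htheta : unit_disk_E R theta) (m : nat) (hm : (1 <= m)%N)
  (hq0 : 0 < pabs R q `^ (m.+1%:R / m%:R))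
  (hq1 : pabs R q `^ (m.+1%:R / m%:R) <= pabs R (theta - 1))
  (hq2 : pabs R (theta - 1) < pabs R q `^ (m.+2%:R / m.+1%:R))
  (hq3 : pabs R q `^ (m.+2%:R / m.+1%:R) < 1) :
  (exists y1 y2 y3 : Qp hp, labelled_roots R theta q y1 y2 y3) /\
  forall y1 y2 y3 : Qp hp, labelled_roots R theta q y1 y2 y3 ->
  [/\ incidence_mx R theta q y1 y2 y3 m = potts_mx m,
      irreducible_mx (incidence_mx R theta q y1 y2 y3 m),
      isometrically_conjugate
        (JJ R theta q y1 y2 y3 m) (potts_bethe theta q)
        (fun x y => pabs R (x - y))
        (subshift (potts_mx m)) (@left_shift m.+3) (@d_f R p hp theta q y1 y2 y3 m) &
      topologically_conjugate
        (subshift (potts_mx m)) (@left_shift m.+3)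
        [set: symb_seq 3] (@left_shift 3)] /\
  [set: Qp hp] =
    basin R theta q 1 `|` JJ R theta q y1 y2 y3 m
    `|` \bigcup_n iter_preimage theta q n [set xinf theta q].
Proof.
have q_ge0 := abs_ge0 (pabs_padic R hp) q.
have t_ge0 := abs_ge0 (pabs_padic R hp) (theta - 1).
have T_gt0 := powR_T_gt0 hq0 hq1.
have TQ := powR_T_lt_Q t_ge0 q_ge0 hq2 hq3.
have Q_lt1 := powR_Q_lt1 hq3.
have Qlam := Q_le_ratioX hm t_ge0 q_ge0 hq0 hq1.
have lamQ := ratioX_lt_Q hm t_ge0 q_ge0 hq0 hq2.
(* Up to sign, 1 - theta - q is q + (theta - 1), where q dominates. *)
have cq : pabs R (1 - theta - q) = pabs R q.
  rewrite -(padic_absN (pabs_padic R hp)) opprB opprB.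
  exact: (absD_dom (pabs_padic R hp)).
rewrite -cq in TQ Q_lt1 Qlam lamQ.
split; first exact: (labelled_roots_exist hp3 T_gt0 TQ Q_lt1).
move=> y1 y2 y3 hy.
have [a [a0 /all_and2[aT fa]]] := exists_backward_orbit hp3 T_gt0 TQ Q_lt1 hy.
have incE := incidenceE hp3 T_gt0 TQ Q_lt1 cq hy a0 aT fa hm Qlam lamQ.
split; last exact: (Qp_decomposition hp3 T_gt0 TQ Q_lt1 cq hy a0 aT fa Qlam lamQ).
split; first exact: incE.
- by rewrite incE; exact: potts_irreducible.
- exact: (JJ_conjugate hp3 T_gt0 TQ Q_lt1 cq hy a0 aT fa hm Qlam lamQ).
- exact: potts_full_shift.
Qed.
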